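(* Let $\mathscr{A}$ be a connected cochain DG algebra over $k$ and let $P$ be a DG $\mathscr{A}$-module whose underlying graded module $P^{\#}$ is a finitely generated $\mathscr{A}^{\#}$-module. If $P$ is semi-projective, then $P$ is semi-free.
   Context: $k$ is an algebraically closed field of characteristic $0$. A cochain DG algebra $\mathscr{A}$ is a $\mathbb{Z}$-graded $k$-algebra with a $k$-linear map $\partial_{\mathscr{A}}$ of degree $1$ such that $\partial_{\mathscr{A}}^2=0$ and $\partial_{\mathscr{A}}(ab)=\partial_{\mathscr{A}}(a)b+(-1)^{|a|}a\partial_{\mathscr{A}}(b)$ for homogeneous $a,b$. Its underlying graded algebra is $\mathscr{A}^{\#}$; $\mathscr{A}$ is connected if $\mathscr{A}^{\#}$ is a connected graded algebra, i.e. $\mathscr{A}^{i}=0$ for $i<0$ and $\mathscr{A}^0=k$. A DG $\mathscr{A}$-module is a complex $(M,\partial_M)$ (differential of degree $1$) which is a graded left $\mathscr{A}$-module with $\partial_M(am)=\partial_{\mathscr{A}}(a)m+(-1)^{|a|}a\partial_M(m)$; $M^{\#}$ is its underlying graded $\mathscr{A}^{\#}$-module. An $\mathscr{A}$-homomorphism $f:M\to N$ of degree $i$ is a $k$-linear map of degree $i$ with $f(am)=(-1)^{i|a|}af(m)$; $\mathrm{Hom}_{\mathscr{A}}(M,N)$ is the complex of all such, with differential $f\mapsto \partial_N\circ f-(-1)^{|f|}f\circ\partial_M$. A DG morphism is a degree $0$ $\mathscr{A}$-homomorphism commuting with the differentials; it is a quasi-isomorphism if it induces an isomorphism on cohomology.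 A DG $\mathscr{A}$-module $P$ is semi-projective if $\mathrm{Hom}_{\mathscr{A}}(P,-)$ preserves surjective quasi-isomorphisms. A DG $\mathscr{A}$-module $F$ is semi-free if $F^{\#}$ has a free homogeneous basis $E$ over $\mathscr{A}^{\#}$ with a decomposition $E=\bigsqcup_{i\ge 0}E_i$ into disjoint graded sets such that $\partial_F(E_0)=0$ and $\partial_F(E_u)\subseteq \mathscr{A}\left(\bigsqcup_{i<u}E_i\right)$ (the $\mathscr{A}$-submodule generated by $\bigsqcup_{i<u}E_i$) for all $u>0$. *)

(* Defs.v *)
From HB Require Import structures.
From mathcomp Require Import all_boot all_order all_algebra.
From mathcomp Require Import boolp functions zify.

Set Implicit Arguments.
Unset Strict Implicit.
Unset Printing Implicit Defensive.

Import GRing.Theory.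
Local Open Scope ring_scope.

(* Graded objects are represented by their total space together with the      *)
(* family of homogeneous components. A subspace is a Prop-valued predicate.   *)

Definition subspace (k : fieldType) (V : lmodType k) (S : V -> Prop) : Prop :=
  S 0 /\ forall (c : k) x y, S x -> S y -> S (c *: x + y).

(* V is the (internal) direct sum of the subspaces V_i, i in Z. *)
Record grading (k : fieldType) (V : lmodType k) (deg : int -> V -> Prop)
    : Prop := Grading {
  grading_sub : forall i, subspace (deg i);
  grading_sum : forall x, exists (s : seq int) (c : int -> V),
    [/\ uniq s, forall i, deg i (c i) & x = \sum_(i <- s) c i];
  grading_free : forall (s : seq int) (c : int -> V),
    uniq s -> (forall i, deg i (c i)) -> \sum_(i <- s) c i = 0 ->
    forall i, i \in s -> c i = 0
}.

(* The terms C^i of a complex are   *)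
(* subspaces of one ambient space, which need not be their direct sum (this   *)
(* lets Hom complexes live in a space of all functions). The value of         *)
(* [cpx_d i] is only meaningful on C^i.                                       *)
Record cochain (k : fieldType) := Cochain {
  cpx_space :> lmodType k;
  cpx_deg : int -> cpx_space -> Prop;
  cpx_d : int -> cpx_space -> cpx_space;
  cpx_sub : forall i, subspace (cpx_deg i);
  cpx_dP : forall i (c : k) x y, cpx_deg i x -> cpx_deg i y ->
    cpx_d i (c *: x + y) = c *: cpx_d i x + cpx_d i y;
  cpx_d_deg : forall i x, cpx_deg i x -> cpx_deg (i + 1) (cpx_d i x);
  cpx_dd : forall i x, cpx_deg i x -> cpx_d (i + 1) (cpx_d i x) = 0
}.

Section Complexes.
Variable k : fieldType.
Implicit Types C D : cochain k.

Definition chain_map C D (f : C -> D) : Prop :=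
  [/\ forall i x, cpx_deg i x -> cpx_deg i (f x),
      forall i (c : k) x y, cpx_deg i x -> cpx_deg i y ->
        f (c *: x + y) = c *: f x + f y
    & forall i x, cpx_deg i x -> f (cpx_d i x) = cpx_d i (f x)].

Definition cocycle C (i : int) (x : C) : Prop := cpx_deg i x /\ cpx_d i x = 0.

Definition coboundary C (i : int) (x : C) : Prop :=
  exists y : C, cpx_deg (i - 1) y /\ cpx_d (i - 1) y = x.

Definition deg_surjective C D (f : C -> D) : Prop :=
  forall i y, cpx_deg i y -> exists x, cpx_deg i x /\ f x = y.

(* A chain map such that H^i(f) : Z^i(C)/B^i(C) -> Z^i(D)/B^i(D) is injective *)
(* and surjective for every i.                                                *)
Definition quasi_iso C D (f : C -> D) : Prop :=
  [/\ chain_map f,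
      forall i x, cocycle i x -> coboundary i (f x) -> coboundary i x
    & forall i y, cocycle i y ->
        exists x, cocycle i x /\ coboundary i (y - f x)].

End Complexes.

(* The k-vector space underlying a left module over a k-algebra. *)
Definition kmod (k : fieldType) (A : algType k) (M : lmodType A) : Type := M.

Section RestrictionOfScalars.
Variables (k : fieldType) (A : algType k) (M : lmodType A).

HB.instance Definition _ := GRing.Zmodule.copy (kmod M) M.

Let kscale (c : k) (x : kmod M) : kmod M := (c%:A : A) *: (x : M).

Fact kmod_scalerA (a b : k) x : kscale a (kscale b x) = kscale (a * b) x.
Proof. by rewrite /kscale scalerA -scalerAl mul1r scalerA. Qed.
Fact kmod_scale1r : left_id 1 kscale.
Proof. by move=> x; rewrite /kscale !scale1r. Qed.
Fact kmod_scalerDr : right_distributive kscale +%R.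
Proof. by move=> c x y; exact: scalerDr. Qed.
Fact kmod_scalerDl x : {morph kscale^~ x : a b / a + b}.
Proof. by move=> a b; rewrite /kscale !scalerDl. Qed.

HB.instance Definition _ := GRing.Zmodule_isLmodule.Build k (kmod M)
  kmod_scalerA kmod_scale1r kmod_scalerDr kmod_scalerDl.

End RestrictionOfScalars.

Definition ksign (k : fieldType) (i : int) : k := (-1) ^+ `|i|%N.

Fact ksignD (k : fieldType) (i j : int) :
  ksign k (i + j) = ksign k i * ksign k j.
Proof.
rewrite /ksign -exprD -[LHS]signr_odd -[RHS]signr_odd.
by congr (_ ^+ nat_of_bool _); lia.
Qed.

Fact ksignK (k : fieldType) (i : int) (s : k) :
  ksign k i * (s * ksign k i) = s.
Proof.
suff sqr1 : ksign k i * ksign k i = 1 by rewrite mulrCA sqr1 mulr1.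
by rewrite /ksign -expr2 sqrr_sign.
Qed.

Record dgAlg (k : fieldType) := DGAlg {
  dga_sort :> algType k;
  dga_deg : int -> dga_sort -> Prop;
  dga_d : {linear dga_sort -> dga_sort};
  dga_grading : grading dga_deg;
  dga_deg1 : dga_deg 0 1;
  dga_degM : forall i j a b,
    dga_deg i a -> dga_deg j b -> dga_deg (i + j) (a * b);
  dga_d_deg : forall i a, dga_deg i a -> dga_deg (i + 1) (dga_d a);
  dga_dd : forall a, dga_d (dga_d a) = 0;
  dga_leibniz : forall i a b, dga_deg i a ->
    dga_d (a * b) = dga_d a * b + ksign k i *: (a * dga_d b)
}.

(* The inclusions k.1 <= A^0 and 0 <= A^i hold by dga_deg1 and dga_grading,   *)
(* and 1 != 0 in any algType.                                                 *)
Definition connected (k : fieldType) (A : dgAlg k) : Prop :=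
  (forall i (a : A), i < 0 -> dga_deg i a -> a = 0) /\
  (forall a : A, dga_deg 0 a -> exists c : k, a = c%:A).

Record dgMod (k : fieldType) (A : dgAlg k) := DGMod {
  dgm_sort :> lmodType A;
  dgm_deg : int -> kmod dgm_sort -> Prop;
  dgm_d : {linear kmod dgm_sort -> kmod dgm_sort};
  dgm_grading : grading dgm_deg;
  dgm_degZ : forall i j (a : A) (x : dgm_sort),
    dga_deg i a -> dgm_deg j x -> dgm_deg (i + j) (a *: x);
  dgm_d_deg : forall i x, dgm_deg i x -> dgm_deg (i + 1) (dgm_d x);
  dgm_dd : forall x, dgm_d (dgm_d x) = 0;
  dgm_leibniz : forall i (a : A) (x : dgm_sort), dga_deg i a ->
    dgm_d (a *: x) = (dga_d A a *: x : kmod dgm_sort)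
      + ksign k i *: (a *: (dgm_d x : dgm_sort) : kmod dgm_sort)
}.

Section DGModules.
Variables (k : fieldType) (A : dgAlg k).
Implicit Types M N P F : dgMod A.

Fact dgm_cpx_dP M (i : int) (c : k) (x y : kmod M) :
  dgm_deg i x -> dgm_deg i y ->
  dgm_d M (c *: x + y) = c *: dgm_d M x + dgm_d M y.
Proof. by move=> _ _; rewrite linearP. Qed.

Definition dgm_cpx M : cochain k :=
  @Cochain k (kmod M) (@dgm_deg k A M) (fun _ => dgm_d M)
    (grading_sub (dgm_grading M)) (@dgm_cpx_dP M) (@dgm_d_deg k A M)
    (fun _ x _ => dgm_dd x).

Definition Ahom M N (i : int) (f : kmod M -> kmod N) : Prop :=
  [/\ forall (c : k) x y, f (c *: x + y) = c *: f x + f y,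
      forall j x, dgm_deg j x -> dgm_deg (j + i) (f x)
    & forall j (a : A) (x : M), dga_deg j a ->
        f (a *: x) = ksign k (i * j) *: (a *: (f x : N) : kmod N)].

Definition dg_morphism M N (f : kmod M -> kmod N) : Prop :=
  Ahom 0 f /\ forall x, f (dgm_d M x) = dgm_d N (f x).

Definition hom_d M N (i : int) (f : kmod M -> kmod N) : kmod M -> kmod N :=
  fun x => dgm_d N (f x) - ksign k i *: f (dgm_d M x).

Let kmodE M (c : k) (x : kmod M) : c *: x = (c%:A : A) *: (x : M).
Proof. by []. Qed.

Let kmod_scaleC M (a : A) (c : k) (x : kmod M) :
  a *: (c *: x : M) = c *: (a *: (x : M) : kmod M).
Proof. by rewrite !kmodE !scalerA mulr_algr mulr_algl. Qed.

Fact Ahom_sub M N i : subspace (@Ahom M N i).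
Proof.
split.
  split=> [c x y|j x _|j a x _]; rewrite /= /GRing.zero /= ?scaler0 ?addr0 //.
  exact: (grading_sub (dgm_grading N) _).1.
move=> c f g [fL fD fA] [gL gD gA]; split=> [b x y|j x xj|j a x aj]; rewrite !fctE.
- rewrite fL gL !scalerDr !scalerA (mulrC c b) -!addrA; congr (_ + _).
  by rewrite addrCA.
- by apply: (grading_sub (dgm_grading N) _).2; [exact: fD|exact: gD].
- rewrite (fA j) // (gA j) // !scalerDr !kmod_scaleC.
  by rewrite !scalerA mulrC.
Qed.

Fact hom_dP M N (i : int) (c : k) (f g : kmod M -> kmod N) :
  Ahom i f -> Ahom i g ->
  hom_d i (c *: f + g) = c *: hom_d i f + hom_d i g.
Proof.
move=> _ _; apply/funext => x; rewrite /hom_d !fctE linearP.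
rewrite !scalerDr scalerN !scalerA (mulrC c) opprD !addrA.
by congr (_ + _); rewrite addrAC.
Qed.

Let Ahom_raddf M N i (f : kmod M -> kmod N) : Ahom i f ->
  [/\ f 0 = 0, forall x y : kmod M, f (x + y) = f x + f y
    & forall (c : k) (x : kmod M), f (c *: x) = c *: f x].
Proof.
case=> fL _ _; have f0 : f 0 = 0.
  by have := fL 1 0 0; rewrite scaler0 addr0 scale1r => /eqP; 
     rewrite -subr_eq subrr => /eqP.
split=> // [x y|c x]; first by rewrite -[x]scale1r fL !scale1r.
by rewrite -[c *: x]addr0 fL f0 addr0.
Qed.

Fact hom_d_deg M N i (f : kmod M -> kmod N) :
  Ahom i f -> Ahom (i + 1) (hom_d i f).
Proof.
move=> fi; have [f0 fD fZ] := Ahom_raddf fi; case: fi => fL fd fA.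
split=> [c x y|j x xj|j a x aj]; rewrite /hom_d.
- rewrite linearP !fL linearP !scalerDr !scalerN !scalerA (mulrC c) opprD.
  by rewrite !addrA; congr (_ + _); rewrite addrAC.
- rewrite [dgm_d N _ - _]addrC -scaleNr; apply: (grading_sub (dgm_grading N) _).2.
    by rewrite (addrC i) addrA; apply/fd/dgm_d_deg.
  by rewrite addrA; exact/dgm_d_deg/fd.
rewrite (fA j) // linearZ /= !(dgm_leibniz _ aj).
rewrite fD fZ (fA (j + 1)) ?(fA j) //; last exact: dga_d_deg.
rewrite mulrDr mulr1 mulrDl mul1r !ksignD scalerBr kmod_scaleC.
rewrite !scalerDr !scalerN !scalerA opprD ksignK.
rewrite addrACA subrr add0r; congr (_ *: _ - _ *: _).
by rewrite mulrC mulrA mulrAC.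
Qed.

Fact hom_dd M N i (f : kmod M -> kmod N) :
  Ahom i f -> hom_d (i + 1) (hom_d i f) = 0.
Proof.
move=> fi; have [f0 fD fZ] := Ahom_raddf fi.
apply/funext => x; rewrite /hom_d linearB linearZ /= !dgm_dd f0 scaler0 subr0.
have s1 : ksign k 1 = -1 by rewrite /ksign expr1.
by rewrite sub0r ksignD s1 mulrN1 scaleNr opprK addNr.
Qed.

Definition Hom_cpx M N : cochain k :=
  @Cochain k (kmod M -> kmod N) (@Ahom M N) (@hom_d M N)
    (@Ahom_sub M N) (@hom_dP M N) (@hom_d_deg M N) (@hom_dd M N).

(* Hom_A(P, g) *)
Definition Hom_post P M N (g : kmod M -> kmod N) : Hom_cpx P M -> Hom_cpx P N :=
  fun f => g \o f.
Arguments Hom_post P [M N] g.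

Fact dg_morphism_chain_map M N (g : dgm_cpx M -> dgm_cpx N) :
  dg_morphism g -> chain_map g.
Proof.
case=> -[gL gd _] gdC; split=> [i x /gd|i c x y _ _|i x _].
- by rewrite addr0.
- exact: gL.
- exact: gdC.
Qed.

Fact Hom_post_chain_map P M N (g : dgm_cpx M -> dgm_cpx N) :
  dg_morphism g -> chain_map (Hom_post P g).
Proof.
case=> g0 gdC; have [_ gD gZ] := Ahom_raddf g0; case: g0 => gL gd gA.
split=> [i f [fL fd fA]|i c f f' _ _|i f _].
- split=> [c x y|j x /fd /gd|j a x aj].
  + by rewrite /Hom_post /= fL gL.
  + by rewrite addr0.
  + by rewrite /Hom_post /= (fA j) // gZ (gA j) // mul0r /ksign expr0 scale1r.
- by apply/funext => x; exact: gL.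
- apply/funext => x; rewrite /Hom_post /= /hom_d /=.
  by rewrite addrC -scaleNr gL gdC scaleNr addrC.
Qed.

Definition semi_projective P : Prop :=
  forall M N (g : dgm_cpx M -> dgm_cpx N), dg_morphism g ->
    deg_surjective g -> quasi_iso g ->
    deg_surjective (Hom_post P g) /\ quasi_iso (Hom_post P g).

End DGModules.

Section SemiFree.
Variables (R : nzRingType) (M : lmodType R).
Implicit Types S : M -> Prop.

Definition submod_span S (x : M) : Prop :=
  exists (s : seq M) (c : M -> R),
    (forall e, e \in s -> S e) /\ x = \sum_(e <- s) c e *: e.

Definition lin_indep S : Prop :=
  forall (s : seq M) (c : M -> R), uniq s -> (forall e, e \in s -> S e) ->
    \sum_(e <- s) c e *: e = 0 -> forall e, e \in s -> c e = 0.

Definition is_basis S : Prop := (forall x, submod_span S x) /\ lin_indep S.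

Definition finitely_generated : Prop :=
  exists s : seq M, forall x, submod_span (fun e => e \in s) x.

End SemiFree.
Arguments finitely_generated {R} M.

Definition semi_free (k : fieldType) (A : dgAlg k) (F : dgMod A) : Prop :=
  exists E : nat -> F -> Prop,
    [/\ is_basis (fun e => exists u, E u e),
        forall u e, E u e -> exists i, dgm_deg i e,
        forall u v e, E u e -> E v e -> u = v,
        forall e, E 0%N e -> dgm_d F e = 0
      & forall u e, (0 < u)%N -> E u e ->
          submod_span (fun x => exists2 i, (i < u)%N & E i x) (dgm_d F e)].

(* Main.v *)
Require Import Defs.
From HB Require Import structures.
From mathcomp Require Import all_boot all_order all_algebra.
From mathcomp Require Import boolp functions.
From mathcomp Require classical_sets.
From mathcomp Require Import zify.
Import Order.TTheory GRing.Theory Num.Theory.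
Local Open Scope ring_scope.

Set Implicit Arguments.
Unset Strict Implicit.
Unset Printing Implicit Defensive.

(* Freeness: a graded A-linear surjection F -> P from a finitely generated    *)
(* free graded module induces a surjection of contractible DG modules         *)
(* C(F) -> C(P); semi-projectivity lifts a canonical degree 1 homomorphism    *)
(* P -> C(P) along it, which splits F -> P. If F comes from a minimal system  *)
(* of generators, the splitting is unitriangular, so these generators form a  *)
(* basis of P.                                                                *)
(*   Filtration: suppose that the basis elements indexed by T span a semi-free*)
(* submodule Q, and T is not everything. It suffices to find a homogeneous x  *)
(* with dx in Q having an invertible coordinate outside T, since x can then   *)
(* replace a basis element. If the differential of P/Q is not minimal, some   *)
(* x = d e_i works. Otherwise let b be the lowest degree of P/Q and U its     *)
(* component of degree b; then d maps U to A^1 U. If d is injective on U, a   *)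
(* linear retraction of d turns U + U (degrees b and b + 1) into an acyclic   *)
(* quotient K of P/Q. As Hom(P, K) is acyclic and Q is semi-free, the         *)
(* quotient map p is dh + hd for some h of degree -1 vanishing on Q. But then *)
(* h vanishes on U and on A^1 U for degree reasons, so p = 0 on U.            *)

(** * Graded vector spaces *)

(** Semi-projectivity is only ever tested against acyclic modules, between which every surjective DG
    morphism is a quasi-isomorphism. This is exploited twice. With the contractible modules
    [coind_dg] it gives a graded splitting of any graded surjection onto P
    ([split_of_semi_projective]); a Nakayama-type argument over the connected algebra A then turns a
    minimal system of homogeneous generators into a basis ([minimal_generators_free]). With K -> 0
    for K acyclic it shows that Hom(P, K) is acyclic ([Hom_acyclic]). This serves to make the
    differential triangular, one basis element at a time ([enlarge_filtered]). If no further element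
    could be added to the semi-free part Q, there would be a non-zero chain map from P to an acyclic
    module [two_term_dg]; it is null-homotopic, by a homotopy that may be taken zero on Q
    ([hom_d_vanishing]) and is then too small for degree reasons ([no_cycle_contradiction]). As the
    rank is finite, the process exhausts the basis ([filtered_complete]). *)

Section VectorSpaces.
Variable k : fieldType.
Implicit Types V W : lmodType k.

(** Zorn's lemma gives a subspace containing S and maximal among those avoiding v. By maximality it
    is a complement of the line kv, and f reads off the coefficient of v. *)
Lemma linear_functional V (S : V -> Prop) (v : V) : subspace S -> ~ S v ->
  exists f : {linear V -> k^o}, (forall x, S x -> f x = 0) /\ f v = 1.
Proof.
move=> [S0 SL] Sv.
(* [Z] does not ask for 0 in A, since the union of the empty chain is empty. A maximal A does
   contain 0: otherwise A would be empty, and S would be larger. *)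
pose Z (A : classical_sets.set V) :=
  [/\ forall (c : k) x y, A x -> A y -> A (c *: x + y),
      forall x y, A x -> S y -> A (x + y) & ~ A v].
have [|A [[AL AS Av] Amax]] := @classical_sets.Zorn_bigcup V Z.
  move=> F FZ Ftot; split.
  - move=> c x y [X FX Xx] [Y FY Yy].
    case: (Ftot X Y FX FY) => [XY|YX].
      by exists Y => //; have [YL _ _] := FZ _ FY; exact/YL/Yy/XY.
    by exists X => //; have [XL _ _] := FZ _ FX; exact/XL/YX.
  - move=> x y [X FX Xx] Sy; exists X => //.
    by have [_ XS _] := FZ _ FX; exact: XS.
  - by case=> X FX Xv; have [_ _] := FZ _ FX; exact.
have A0 : A 0.
  apply: contrapT => NA0.
  have Aempty x : ~ A x.
    by move=> Ax; apply: NA0; have := AL (- 1) x x Ax Ax; rewrite scaleN1r addNr.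
  apply: (Amax S); last split => //.
    by split=> [x /Aempty//|/(_ _ S0)/Aempty].
  by move=> x y Sx Sy; have := SL 1 x y Sx Sy; rewrite scale1r.
have SA x : S x -> A x by move=> Sx; rewrite -[x]add0r; exact: AS.
have AD x y : A x -> A y -> A (x + y).
  by move=> Ax Ay; have := AL 1 x y Ax Ay; rewrite scale1r.
have AZ c x : A x -> A (c *: x).
  by move=> Ax; have := AL c x 0 Ax A0; rewrite addr0.
have AB x y : A x -> A y -> A (x - y).
  by move=> Ax Ay; rewrite -scaleN1r; apply: AD => //; exact: AZ.
have coef x : exists c : k, A (x - c *: v).
  have [Ax|NAx] := pselect (A x); first by exists 0; rewrite scale0r subr0.
  pose B : classical_sets.set V := fun z =>
    exists (t : k) w, A w /\ z = w + t *: x.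
  have [Bv|NBv] := pselect (B v); last first.
    case: (Amax B); last first.
      split=> // [c y z [t [w [Aw ->]]] [t' [w' [Aw' ->]]]|y z [t [w [Aw ->]]] Sz].
        exists (c * t + t'), (c *: w + w'); split; first exact: AL.
        by rewrite scalerDr scalerA scalerDl addrACA.
      exists t, (w + z); split; first exact: AS.
      by rewrite addrAC.
    split=> [y Ay|BA]; first by exists 0, y; rewrite scale0r addr0.
    by apply/NAx/BA; exists 1, 0; rewrite scale1r add0r.
  case: Bv => t [w [Aw vE]].
  have t0 : t != 0.
    by apply/eqP => t0; apply: Av; rewrite vE t0 scale0r addr0.
  exists t^-1; rewrite vE scalerDr scalerA mulVf // scale1r opprD addrCA subrr addr0.
  by rewrite -scaleNr; exact: AZ.
have [f fP] := choice coef.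
have fu x c : A (x - c *: v) -> f x = c.
  move=> Ac; apply: contrapT => fc; apply: Av.
  have E : x - f x *: v - (x - c *: v) = (c - f x) *: v.
    by rewrite opprB addrC addrA subrK scalerBl.
  have := AZ (c - f x)^-1 _ (AB _ _ (fP x) Ac).
  rewrite E scalerA mulVf ?scale1r //.
  by rewrite subr_eq0; apply/eqP => /esym.
have fL : linear (f : V -> k^o).
  move=> c x y; apply: fu.
  rewrite [_ *: v]scalerDl -[(c * f x) *: v]scalerA opprD addrACA -scalerBr.
  exact: AL.
pose g : {linear V -> k^o} :=
  HB.pack (f : V -> k^o) (GRing.isLinear.Build _ _ _ _ _ fL).
exists g; split=> [x Sx|]; rewrite /= ; apply: fu.
  by rewrite scale0r subr0; exact: SA.
by rewrite scale1r subrr.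
Qed.

Lemma subspaceD V (S : V -> Prop) x y : subspace S -> S x -> S y -> S (x + y).
Proof. by case=> _ SL Sx Sy; rewrite -[x]scale1r; exact: SL. Qed.

Lemma subspaceZ V (S : V -> Prop) c x : subspace S -> S x -> S (c *: x).
Proof. by case=> S0 SL Sx; rewrite -[_ *: _]addr0; exact: SL. Qed.

Lemma subspace_sum V (S : V -> Prop) I (r : seq I) (Q : pred I) (F : I -> V) :
  subspace S -> (forall i, Q i -> S (F i)) -> S (\sum_(i <- r | Q i) F i).
Proof.
by move=> SS SF; apply: big_ind => //; [case: SS|move=> x y; exact: subspaceD].
Qed.

(** * Gradings and maps defined degree by degree *)

Section Grading.
Variables (V : lmodType k) (deg : int -> V -> Prop).

Lemma grading_ind (gr : grading deg) (Q : V -> Prop) :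
  Q 0 -> (forall x y, Q x -> Q y -> Q (x + y)) ->
  (forall i x, deg i x -> Q x) -> forall x, Q x.
Proof.
move=> Q0 QD Qd x; have [s [c [_ cd ->]]] := grading_sum gr x.
by apply: big_ind => // i _; exact: Qd (cd i).
Qed.

Lemma sum_by_fst (W : zmodType) T (l : seq (int * T)) (F : int * T -> W) :
  \sum_(p <- l) F p
    = \sum_(i <- undup [seq p.1 | p <- l]) \sum_(p <- l | p.1 == i) F p.
Proof.
have sub : {subset [seq p.1 | p <- l] <= undup [seq p.1 | p <- l]}.
  by move=> i; rewrite mem_undup.
elim: l (undup _) (undup_uniq [seq p.1 | p <- l]) sub => [|p l IH] u uu sub.
  by rewrite big_nil big1 // => i _; rewrite big_nil.
rewrite big_cons (IH u) //; last by move=> i il; apply: sub; rewrite inE il orbT.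
have pu : p.1 \in u by apply: sub; rewrite inE eqxx.
rewrite (bigD1_seq p.1) //= [in RHS](bigD1_seq p.1) //= big_cons eqxx addrA.
congr (_ + _); apply: eq_bigr => i ip.
by rewrite big_cons eq_sym (negPf ip).
Qed.

(** The graph R of the glued map is built from finite lists of homogeneous pieces. It is
    single-valued: once pieces of equal degree are grouped, directness of the sum kills every group
    of a decomposition of 0. *)
Lemma grading_extend (W : lmodType k) (gr : grading deg)
    (g : int -> {linear V -> W}) :
  exists f : {linear V -> W}, forall i x, deg i x -> f x = g i x.
Proof.
pose R x y := exists l : seq (int * V),
  [/\ forall p, p \in l -> deg p.1 p.2, x = \sum_(p <- l) p.2
    & y = \sum_(p <- l) g p.1 p.2].
have RL c x y x' y' : R x x' -> R y y' -> R (c *: x + y) (c *: x' + y').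
  move=> [l [lh -> ->]] [m [mh -> ->]].
  exists ([seq (p.1, c *: p.2) | p <- l] ++ m); split.
  - move=> p; rewrite mem_cat => /orP[/mapP[q /lh qd ->]|/mh//].
    by apply: subspaceZ (grading_sub gr _) _.
  - by rewrite big_cat big_map scaler_sumr.
  - rewrite big_cat big_map scaler_sumr; congr (_ + _).
    by apply: eq_bigr => p _; rewrite linearZ.
have R0 y : R 0 y -> y = 0.
  move=> [l [lh l0 ->]]; rewrite sum_by_fst.
  move: l0; rewrite sum_by_fst; set u := undup _ => /esym l0.
  have cd i : deg i (\sum_(p <- l | p.1 == i) p.2).
    rewrite big_seq_cond; apply: subspace_sum (grading_sub gr i) _ => p.
    by move=> /andP[/lh + /eqP<-].
  have c0 := grading_free gr (undup_uniq _) cd l0.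
  rewrite big1_seq // => i /andP[_ iu].
  rewrite (eq_bigr (fun p => g i p.2)) => [|p /eqP -> //].
  by rewrite -linear_sum c0 ?linear0.
have Rtot x : exists y, R x y.
  move: x; apply: (grading_ind gr) => [|x y [x' Rx] [y' Ry]|i x xi] //.
  - by exists 0, [::]; rewrite !big_nil.
  - by exists (1 *: x' + y'); rewrite -[x]scale1r; exact: RL.
  - exists (g i x), [:: (i, x)]; rewrite !big_seq1; split=> // p.
    by rewrite inE => /eqP ->.
have [f fP] := choice Rtot.
have Rf x y : R x y -> f x = y.
  move=> Ry; apply/eqP; rewrite -subr_eq0; apply/eqP/R0.
  by have := RL (- 1) _ _ _ _ Ry (fP x); rewrite !scaleN1r addNr addrC.
have fL : linear f by move=> c x y; apply/Rf/RL.
pose h : {linear V -> W} :=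
  HB.pack f (GRing.isLinear.Build _ _ _ _ _ fL).
exists h => i x xi; apply: Rf; exists [:: (i, x)]; rewrite !big_seq1; split=> // p.
by rewrite inE => /eqP ->.
Qed.

(** A criterion for modules whose components are defined by hand: additive projections give
    uniqueness of decompositions, and the induction principle says that homogeneous elements
    generate. *)
Lemma grading_of_proj (pr : int -> V -> V) :
  (forall i, subspace (deg i)) -> (forall i, {morph pr i : x y / x + y}) ->
  (forall i x, deg i (pr i x)) -> (forall i x, deg i x -> pr i x = x) ->
  (forall i j x, deg j x -> i != j -> pr i x = 0) ->
  (forall Q : V -> Prop, Q 0 -> (forall x y, Q x -> Q y -> Q (x + y)) ->
    (forall i x, deg i x -> Q x) -> forall x, Q x) ->
  grading deg.
Proof.
move=> degS prD prd prE pr0 ind.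
have pr00 i : pr i 0 = 0.
  by have := prD i 0 0; rewrite addr0 => /eqP; rewrite -subr_eq subrr => /eqP.
have pad (s t : seq int) (F : int -> V) : uniq s -> uniq t -> {subset s <= t} ->
    (forall i, i \notin s -> F i = 0) -> \sum_(i <- t) F i = \sum_(i <- s) F i.
  move=> us ut st F0; rewrite (bigID (mem s)) /= [X in _ + X]big1 ?addr0 //.
  rewrite -big_filter; apply: perm_big; apply: uniq_perm => //.
    exact: filter_uniq.
  by move=> i; rewrite mem_filter; apply: andb_idr; exact: st.
split=> // [x|s c us cd c0 i si].
  suff: exists s : seq int, [/\ uniq s, forall i, i \notin s -> pr i x = 0
      & x = \sum_(i <- s) pr i x].
    by case=> s [us _ xE]; exists s, (pr^~ x); split.
  move: x; apply: ind => [|x y [s [us s0 sE]] [t [ut t0 tE]]|i x xi].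
  - by exists [::]; rewrite big_nil.
  - exists (undup (s ++ t)); split; first exact: undup_uniq.
      by move=> i; rewrite mem_undup mem_cat negb_or => /andP[/s0 + /t0]; 
         rewrite prD => -> ->; rewrite addr0.
    under eq_bigr do rewrite prD.
    have sub i : (i \in s -> i \in undup (s ++ t)) *
        (i \in t -> i \in undup (s ++ t)).
      by split=> it; rewrite mem_undup mem_cat it ?orbT.
    have uu := undup_uniq (s ++ t).
    rewrite big_split /=; congr (_ + _).
      by rewrite [LHS]sE; apply/esym/pad => // i; exact: (sub i).1.
    by rewrite [LHS]tE; apply/esym/pad => // i; exact: (sub i).2.
  - exists [:: i]; split=> // [j|]; last by rewrite big_seq1 prE.
    by rewrite inE; exact: pr0.
have := pr00 i; rewrite -[in pr i 0]c0 (big_morph _ (prD i) (pr00 i)).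
rewrite (bigD1_seq i) //= prE // big1 ?addr0 // => j ji.
by rewrite (pr0 _ j) // eq_sym.
Qed.

Variable gr : grading deg.

Definition gext (W : lmodType k) (g : int -> {linear V -> W}) : {linear V -> W} :=
  projT1 (cid (grading_extend gr g)).

Lemma gextE (W : lmodType k) (g : int -> {linear V -> W}) i x :
  deg i x -> gext g x = g i x.
Proof. by move=> xi; rewrite /gext; case: cid => f /= fE; exact: fE. Qed.

Definition gproj j : {linear V -> V} :=
  gext (fun i => if i == j then idfun : {linear V -> V} else \0 : {linear V -> V}).

Lemma gproj_id i x : deg i x -> gproj i x = x.
Proof. by move=> xi; rewrite /gproj (gextE _ xi) eqxx. Qed.

Lemma gproj_neq i j x : deg j x -> i != j -> gproj i x = 0.
Proof. by move=> xj; rewrite eq_sym /gproj (gextE _ xj) => /negPf ->. Qed.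

Lemma gproj_deg i x : deg i (gproj i x).
Proof.
have S := grading_sub gr i; move: x.
apply: (grading_ind gr) => [|x y xd yd|j x xj].
- by rewrite linear0; case: S.
- by rewrite linearD; exact: subspaceD.
- have [->|ij] := eqVneq i j; first by rewrite gproj_id.
  by rewrite (gproj_neq xj ij); case: S.
Qed.

Definition gsign : {linear V -> V} :=
  gext (fun i => ksign k i \*: idfun : {linear V -> V}).

Lemma gsignE i x : deg i x -> gsign x = ksign k i *: x.
Proof. by move=> xi; rewrite /gsign (gextE _ xi). Qed.

Lemma gsign_deg i x : deg i x -> deg i (gsign x).
Proof.
by move=> xi; rewrite (gsignE xi); exact: subspaceZ (grading_sub gr _) xi.
Qed.

Lemma gsignK : involutive gsign.
Proof.
apply: (grading_ind gr) => [|x y xE yE|i x xi].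
- by rewrite !linear0.
- by rewrite !linearD xE yE.
- rewrite (gsignE xi) linearZ /= (gsignE xi) scalerA.
  by have := ksignK i (1 : k); rewrite mul1r => ->; rewrite scale1r.
Qed.

End Grading.
End VectorSpaces.

(** * Graded modules and contractible DG modules *)

Section GradedModules.
Variables (k : fieldType) (A : dgAlg k).

Lemma kmodE (M : lmodType A) (c : k) (x : kmod M) :
  c *: x = (c%:A : A) *: (x : M).
Proof. by []. Qed.

Lemma kmod_scaleC (M : lmodType A) (a : A) (c : k) (x : kmod M) :
  a *: (c *: x : M) = c *: (a *: (x : M) : kmod M).
Proof. by rewrite !kmodE !scalerA mulr_algr mulr_algl. Qed.

Lemma kmod_scaleA (M : lmodType A) (a : A) (c : k) (x : M) :
  (c *: a) *: x = c *: (a *: x : kmod M).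
Proof. by rewrite kmodE scalerA mulr_algl. Qed.

Lemma ksign0 : ksign k 0 = 1. Proof. by []. Qed.
Lemma ksign1 : ksign k 1 = -1. Proof. by []. Qed.

Lemma ksign_sqr i : ksign k i * ksign k i = 1.
Proof. by have := ksignK i (1 : k); rewrite mul1r. Qed.

Lemma dga_d1 : dga_d A 1 = 0.
Proof.
have := dga_leibniz 1 (dga_deg1 A).
rewrite !mulr1 mul1r ksign0 scale1r => /eqP.
by rewrite -subr_eq subrr eq_sym => /eqP.
Qed.

Lemma dga_dC (c : k) : dga_d A (c%:A) = 0.
Proof. by rewrite linearZ /= dga_d1 scaler0. Qed.

Record grMod := GrMod {
  grm_sort :> lmodType A;
  grm_deg : int -> kmod grm_sort -> Prop;
  grm_grading : grading grm_deg;
  grm_degZ : forall i j (a : A) (x : grm_sort),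
    dga_deg i a -> grm_deg j x -> grm_deg (i + j) (a *: x)
}.

Definition gr_of_dg (M : dgMod A) : grMod :=
  GrMod (dgm_grading M) (@dgm_degZ k A M).

Section Sign.
Variable G : grMod.

Definition msign : {linear kmod G -> kmod G} := gsign (grm_grading G).

Lemma msignZk (c : k) (x : kmod G) : msign (c *: x) = c *: msign x.
Proof. exact: linearZ. Qed.

Lemma msignK : involutive msign. Proof. exact: gsignK. Qed.

Lemma msignZ i (a : A) (x : G) : dga_deg i a ->
  msign (a *: x) = ksign k i *: (a *: (msign x : G) : kmod G).
Proof.
move=> ai; move: x; apply: (grading_ind (grm_grading G)) => [|x y xE yE|j x xj].
- by rewrite scaler0 !(linear0 msign) scaler0 scaler0.
- by rewrite scalerDr !(linearD msign) scalerDr xE yE scalerDr.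
- rewrite /msign (gsignE _ (grm_degZ ai xj)) (gsignE _ xj) ksignD.
  by rewrite kmod_scaleC scalerA.
Qed.

(** The Leibniz rule with its sign absorbed by moving [msign] past a; this is what makes the action
    on [coind] associative. *)
Lemma msign_dM (a b : A) (y : G) :
  msign (dga_d A (a * b) *: y)
    = a *: (msign (dga_d A b *: y) : G) + msign (dga_d A a *: (b *: y)).
Proof.
move: a; apply: (grading_ind (dga_grading A)) => [|a c aE cE|i a ai].
- by rewrite mul0r !linear0 !scale0r (linear0 msign) addr0.
- by rewrite mulrDl !linearD !scalerDl !(linearD msign) aE cE addrACA.
rewrite (dga_leibniz _ ai) scalerDl (linearD msign) addrC scalerA; congr (_ + _).
rewrite kmod_scaleA msignZk -scalerA (msignZ _ ai) scalerA ksign_sqr.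
by rewrite scale1r.
Qed.

(* (x, y) stands for x + d(ty) in the DG module freely generated by G, where t *)
(* is [msign]: the action is forced by a(dz) = (-1)^|a| (d(az) - (da)z), and   *)
(* the twist by t removes the sign in front of the second component of a(x, y).*)
Definition coind : Type := (G * G)%type.
HB.instance Definition _ := GRing.Zmodule.copy coind (G * G)%type.

Definition coind_scale (a : A) (p : coind) : coind :=
  (a *: p.1 + msign (dga_d A a *: p.2), a *: p.2).

Fact coind_scalerA (a b : A) p :
  coind_scale a (coind_scale b p) = coind_scale (a * b) p.
Proof.
congr (_, _) => /=; last by rewrite scalerA.
by rewrite msign_dM scalerDr scalerA addrA.
Qed.

Fact coind_scale1r : left_id 1 coind_scale.
Proof.
move=> [x y]; rewrite /coind_scale /= !scale1r dga_d1 scale0r (linear0 msign).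
by rewrite addr0.
Qed.

Fact coind_scalerDr : right_distributive coind_scale +%R.
Proof.
move=> a [x y] [x' y']; congr (_, _); rewrite /= scalerDr //.
by rewrite scalerDr (linearD msign) addrACA.
Qed.

Fact coind_scalerDl x : {morph coind_scale^~ x : a b / a + b}.
Proof.
move=> a b; congr (_, _); rewrite /= scalerDl //.
by rewrite linearD scalerDl (linearD msign) addrACA.
Qed.

HB.instance Definition _ := GRing.Zmodule_isLmodule.Build A coind
  coind_scalerA coind_scale1r coind_scalerDr coind_scalerDl.

Lemma coind_scaleE (a : A) (p : coind) :
  a *: p = (a *: p.1 + msign (dga_d A a *: p.2), a *: p.2).
Proof. by []. Qed.

Lemma coind_kscaleE (c : k) (p : kmod coind) :
  c *: p = (c *: (p.1 : kmod G), c *: (p.2 : kmod G)).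
Proof. by rewrite kmodE coind_scaleE dga_dC scale0r (linear0 msign) addr0. Qed.

Definition coind_deg (n : int) (p : kmod coind) :=
  grm_deg n (p.1 : kmod G) /\ grm_deg (n - 1) (p.2 : kmod G).

Fact coind_grading : grading coind_deg.
Proof.
have gG := grm_grading G.
apply: (@grading_of_proj _ _ _
  (fun i (p : kmod coind) => (gproj gG i p.1, gproj gG (i - 1) p.2))).
- move=> i; split; first by split; exact: (grading_sub gG _).1.
  move=> c x y [x1 x2] [y1 y2]; rewrite coind_kscaleE.
  by split; apply: (grading_sub gG _).2.
- by move=> i [x y] [x' y']; rewrite /= !linearD.
- by move=> i [x y]; split; exact: gproj_deg.
- by move=> i [x y] [/= xi yi]; rewrite !gproj_id.
- move=> i j [x y] [/= xi yi] ij; rewrite (gproj_neq _ xi) // (gproj_neq _ yi) //.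
  by apply: contra_neq ij; lia.
move=> Q Q0 QD Qd [x y]; have -> : (x, y) = (x, 0) + (0, y) :> kmod coind.
  by congr (_, _); rewrite ?addr0 ?add0r.
apply: (QD).
  move: x; apply: (grading_ind gG) => // [x x' xQ x'Q|i x xi].
    have -> : (x + x', 0) = (x, 0) + (x', 0) :> kmod coind.
      by congr (_, _); rewrite addr0.
    exact: QD.
  by apply: (Qd i); split => //; exact: (grading_sub gG _).1.
move: y; apply: (grading_ind gG) => // [y y' yQ y'Q|i y yi].
  have -> : (0, y + y') = (0, y) + (0, y') :> kmod coind.
    by congr (_, _); rewrite addr0.
  exact: QD.
by apply: (Qd (i + 1)); split; rewrite /= ?addrK //; exact: (grading_sub gG _).1.
Qed.

(** In the reading of (x, y) as x + d(ty), the differential is dx = d(t(tx)), because t is an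
    involution and dd = 0. *)
Definition coind_d_fun (p : kmod coind) : kmod coind := (0, msign p.1).

Fact coind_d_linear : linear coind_d_fun.
Proof.
move=> c p q; rewrite /coind_d_fun [c *: p]coind_kscaleE coind_kscaleE.
by congr (_, _); rewrite /= ?linearP // scaler0 addr0.
Qed.

HB.instance Definition _ := GRing.isLinear.Build k (kmod coind) (kmod coind) _
  coind_d_fun coind_d_linear.

Fact coind_degZ i j (a : A) (x : coind) :
  dga_deg i a -> coind_deg j x -> coind_deg (i + j) (a *: x).
Proof.
move=> ai [x1 x2]; split => /=; last by rewrite -addrA; exact: grm_degZ.
apply: (subspaceD (grading_sub (grm_grading G) _)); first exact: grm_degZ.
apply: gsign_deg.
have -> : i + j = (i + 1) + (j - 1) by lia.
by apply: grm_degZ => //; exact: dga_d_deg.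
Qed.

Fact coind_d_deg i x : coind_deg i x -> coind_deg (i + 1) (coind_d_fun x).
Proof.
move=> [x1 x2]; split; first exact: (grading_sub (grm_grading G) _).1.
by rewrite /= addrK; exact: gsign_deg.
Qed.

Fact coind_dd x : coind_d_fun (coind_d_fun x) = 0.
Proof. by rewrite /coind_d_fun /= linear0. Qed.

Fact coind_leibniz i (a : A) (x : coind) : dga_deg i a ->
  coind_d_fun (a *: x) = (dga_d A a *: x : kmod coind)
      + ksign k i *: (a *: (coind_d_fun x : coind) : kmod coind).
Proof.
move=> ai; rewrite /coind_d_fun coind_kscaleE !coind_scaleE /= dga_dd.
rewrite scale0r (linear0 msign) addr0 scaler0 add0r (linearD msign) msignK.
have dai := dga_d_deg ai; apply: injective_projections => /=.
  rewrite (msignZ _ dai) msignK scalerA ksignD mulrA ksign_sqr ksign1 mul1r.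
  by rewrite scaleN1r subrr.
by rewrite addrC (msignZ _ ai).
Qed.

Definition coind_dg : dgMod A :=
  DGMod coind_grading coind_degZ coind_d_deg coind_dd coind_leibniz.

End Sign.
End GradedModules.

(** * Semi-projective modules are graded projective *)

Section Projectivity.
Variables (k : fieldType) (A : dgAlg k).

Definition acyclic (M : dgMod A) : Prop :=
  forall i (x : dgm_cpx M), cocycle i x -> coboundary i x.

Lemma coind_acyclic (G : grMod A) : acyclic (coind_dg G).
Proof.
move=> i [x y] [[/= xi yi] /(congr1 snd) /= x0].
exists (msign G y, 0); split.
  by split; [exact: gsign_deg|exact: (grading_sub (grm_grading G) _).1].
congr (_, _); last by rewrite /= msignK.
by rewrite -[LHS](linear0 (msign G)) -x0 msignK.
Qed.

Lemma acyclic_quasi_iso (M N : dgMod A) (g : dgm_cpx M -> dgm_cpx N) :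
  acyclic M -> acyclic N -> dg_morphism g -> quasi_iso g.
Proof.
move=> acM acN gm; have gc := dg_morphism_chain_map gm.
split=> // [i x xc _|i y yc]; first exact: acM.
have M0 := (grading_sub (dgm_grading M) i).1.
exists 0; split; first by split => //; exact: linear0.
have [_ gL _] := gc.
have := gL i 1 0 0 M0 M0; rewrite scaler0 addr0 scale1r => /eqP.
by rewrite -subr_eq subrr => /eqP <-; rewrite subr0; exact: acN.
Qed.

Lemma Ahom_general (M N : dgMod A) n (f : kmod M -> kmod N) :
  Ahom n f -> (forall j, ksign k (n * j) = 1) ->
  forall (a : A) (x : M), f (a *: x) = a *: (f x : N).
Proof.
move=> [fL _ fA] n1 a x; move: a.
have f0 : f 0 = 0.
  have := fL 1 0 0; rewrite scaler0 addr0 scale1r => /eqP.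
  by rewrite -subr_eq subrr => /eqP.
have fD x' y : f (x' + y) = f x' + f y by rewrite -[x']scale1r fL !scale1r.
apply: (grading_ind (dga_grading A)) => [|a b aE bE|i a ai].
- by rewrite !scale0r.
- by rewrite !scalerDl fD aE bE.
- by rewrite (fA i) // n1 scale1r.
Qed.

Section Lift.
Variables (P : dgMod A) (F : grMod A) (phi : {linear F -> P}).
Hypothesis phid : forall i (x : kmod F),
  grm_deg i x -> dgm_deg i (phi x : kmod P).
Hypothesis phis : forall i (y : kmod P), dgm_deg i y ->
  exists2 x : kmod F, grm_deg i x & phi x = y.

Let G := gr_of_dg P.

Lemma phi_msign (x : kmod F) : phi (msign F x) = msign G (phi x).
Proof.
move: x; apply: (grading_ind (grm_grading F)) => [|x y xE yE|i x xi].
- by rewrite !linear0.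
- by rewrite !linearD xE yE.
- rewrite {1}/msign (gsignE _ xi) kmodE linearZ /=.
  by rewrite /msign (gsignE (grm_grading G) (phid xi)).
Qed.

Definition coind_map (p : kmod (coind F)) : kmod (coind G) := (phi p.1, phi p.2).

Lemma coind_map_morphism :
  @dg_morphism _ _ (coind_dg F) (coind_dg G) coind_map.
Proof.
split; last by move=> [x y]; congr (_, _); rewrite /= ?linear0 // phi_msign.
have phiZ c (x : kmod F) : phi (c *: x) = c *: (phi x : kmod P).
  by rewrite kmodE linearZ.
split.
- move=> c [x y] [x' y']; rewrite /coind_map !coind_kscaleE.
  by congr (_, _); rewrite /= !linearD phiZ.
- by move=> j [x y] [/= xj yj]; rewrite addr0; split; exact: phid.
- move=> j a [x y] aj; rewrite mul0r ksign0 scale1r /coind_map !coind_scaleE /=.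
  by congr (_, _); rewrite ?linearD !linearZ //= phi_msign linearZ.
Qed.

(** The map lifted is the difference between the differential of the free DG module on P and that of
    P: their Leibniz terms cancel, so it is A-linear of degree 1. Surjectivity on Hom complexes
    lifts all elements, not only cocycles, and the second component of the lift is a section up to
    sign. *)
Lemma split_of_semi_projective : semi_projective P ->
  exists s : {linear P -> F},
    (forall i x, dgm_deg i x -> grm_deg i (s x : kmod F)) /\
    forall x, phi (s x) = x.
Proof.
move=> projP.
have [] := projP (coind_dg F) (coind_dg G) coind_map coind_map_morphism.
- move=> i [x y] [/= xi yi].
  have [x' x'd x'E] := phis xi; have [y' y'd y'E] := phis yi.
  by exists (x', y'); split => //; rewrite /coind_map /= x'E y'E.
- by apply: acyclic_quasi_iso coind_map_morphism; exact: coind_acyclic.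
move=> lift _.
(* A-linear only thanks to the twisted action on [coind]; not a chain map.    *)
pose f (x : kmod P) : kmod (coind G) := (- dgm_d P x, msign G x).
have fA : @Ahom _ _ P (coind_dg G) 1 f.
  split.
  - move=> c x y; rewrite /f coind_kscaleE.
    by congr (_, _); rewrite /= !linearP ?opprD ?scalerN.
  - move=> j x xj; split => /=; last by rewrite addrK; exact: gsign_deg.
    rewrite -scaleN1r; apply: (subspaceZ _ (grading_sub (dgm_grading P) _)).
    exact: dgm_d_deg.
  - move=> j a x aj; rewrite mul1r /f coind_scaleE coind_kscaleE /=.
    apply: injective_projections => /=; last exact: (@msignZ _ _ G _ _ x aj).
    rewrite (dgm_leibniz _ aj) (@msignZ _ _ G _ _ _ (dga_d_deg aj)) msignK.
    rewrite scalerDr scalerA.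
    rewrite ksignD mulrA ksign_sqr ksign1 mul1r scaleN1r opprD addrC.
    by congr (_ - _); rewrite (@scalerN _ P) scalerN.
have [h [[hL hd hA] hE]] := lift 1 f fA.
have hD x y : h (x + y) = h x + h y by rewrite -[x]scale1r hL !scale1r.
have h0 : h 0 = 0 by apply/(addIr (h 0)); rewrite -hD !add0r.
(* The twist by [msign] cancels the sign (-1)^|a| of the degree 1 map h, and the second component of
   [coind] sits one degree lower, so s is A-linear of degree 0. *)
pose s (x : P) : F := msign F (h x).2.
have sD x y : s (x + y) = s x + s y by rewrite /s hD linearD.
have sZ (a : A) (x : P) : s (a *: x) = a *: s x.
  move: a; apply: (grading_ind (dga_grading A)) => [|a b aE bE|i a ai].
  - by rewrite !scale0r /s h0 linear0.
  - by rewrite !scalerDl sD aE bE.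
  rewrite /s (hA i) // mul1r coind_kscaleE /= msignZk (msignZ _ ai) scalerA.
  by rewrite ksign_sqr scale1r.
have sL : linear s by move=> a x y; rewrite sD sZ.
pose t : {linear P -> F} :=
  HB.pack s (GRing.isLinear.Build _ _ _ _ _ sL).
exists t; split=> [i x /hd [_]|x]; first by rewrite /= addrK; exact: gsign_deg.
rewrite /= /s phi_msign; have /(congr1 (fun u => (u x).2)) /= := hE.
by rewrite /Hom_post /= => ->; rewrite msignK.
Qed.
End Lift.

Section FreeGraded.
Variables (n : nat) (dl : 'I_n -> int).

Definition free_deg m (v : kmod 'rV[A]_n) := forall i, dga_deg (m - dl i) (v 0 i).

Fact free_grading : grading free_deg.
Proof.
have gA := dga_grading A.
have kE (c : k) (v : kmod 'rV[A]_n) i : (c *: v) 0 i = c *: (v 0 i).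
  by rewrite kmodE mxE mulr_algl.
apply: (@grading_of_proj _ _ _
  (fun m (v : kmod 'rV[A]_n) => \row_i gproj gA (m - dl i) (v 0 i))).
- move=> m; split=> [i|c x y xd yd i].
    by rewrite mxE; exact: (grading_sub gA _).1.
  by rewrite mxE kE; exact: (grading_sub gA _).2.
- by move=> m x y; apply/rowP => i; rewrite !mxE linearD.
- by move=> m x i; rewrite mxE; exact: gproj_deg.
- by move=> m x xd; apply/rowP => i; rewrite mxE gproj_id.
- move=> m j x xd mj; apply/rowP => i; rewrite !mxE (gproj_neq _ (xd i)) //.
  by apply: contra_neq mj; lia.
move=> Q Q0 QD Qd v; rewrite [v]row_sum_delta; apply: big_ind => // i _.
move: (v 0 i); apply: (grading_ind gA) => [|a b aQ bQ|m a am].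
- by rewrite scale0r.
- by rewrite scalerDl; exact: QD.
apply: (Qd (m + dl i)) => j; rewrite !mxE eqxx /=; case: eqP => [->|_].
  by rewrite mulr1 addrK.
by rewrite mulr0; exact: (grading_sub gA _).1.
Qed.

Fact free_degZ i j (a : A) (x : 'rV[A]_n) :
  dga_deg i a -> free_deg j x -> free_deg (i + j) (a *: x).
Proof. by move=> ai xj l; rewrite mxE -addrA; exact: dga_degM. Qed.

Definition free_gr := GrMod free_grading free_degZ.
End FreeGraded.

End Projectivity.

(** * Minimal generators *)

Section Generators.
Variables (k : fieldType) (A : dgAlg k) (P : dgMod A).

Lemma gproj_scale m j (a : A) (x : P) : dgm_deg j x ->
  gproj (dgm_grading P) m (a *: x) = gproj (dga_grading A) (m - j) a *: x.
Proof.
move=> xj; move: a; apply: (grading_ind (dga_grading A)) => [|a b aE bE|i a ai].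
- by rewrite linear0 !scale0r linear0.
- by rewrite linearD !scalerDl linearD aE bE.
have [mE|mj] := eqVneq (m - j) i.
  have -> : m = i + j by lia.
  by rewrite gproj_id ?addrK ?gproj_id //; exact: dgm_degZ.
rewrite (gproj_neq _ ai mj) scale0r (gproj_neq _ (dgm_degZ ai xj)) //.
by apply: contra_neq mj; lia.
Qed.

Definition hom_gen n (e : 'I_n -> P) (dl : 'I_n -> int) : Prop :=
  (forall i, dgm_deg (dl i) (e i)) /\
  (forall x, exists c : 'I_n -> A, x = \sum_i c i *: e i).

(** The homogeneous components of finitely many generators again form a finite generating system. *)
Lemma homogeneous_generators : finitely_generated P ->
  exists n e dl, @hom_gen n e dl.
Proof.
move=> [s sP].
pose span (l : seq P) (x : P) := forall S : P -> Prop,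
  S 0 -> (forall x y, S x -> S y -> S (x + y)) ->
  (forall a x, S x -> S (a *: x)) -> (forall y, y \in l -> S y) -> S x.
pose hom (l : seq P) := forall y, y \in l -> exists i, dgm_deg i y.
have span1 x : exists2 l, hom l & span l x.
  move: x; apply: (grading_ind (dgm_grading P)) => [|x y [l lh lx] [m mh my]|i x xi].
  - by exists [::].
  - exists (l ++ m) => [z|S S0 SD SZ Sl].
      by rewrite mem_cat => /orP[/lh|/mh].
    by apply: (SD); [apply: (lx S)|apply: (my S)] => // z zl; apply: Sl;
      rewrite mem_cat zl ?orbT.
  - exists [:: x] => [y|S _ _ _]; last by apply; rewrite inE.
    by rewrite inE => /eqP ->; exists i.
have [l lh ls] : exists2 l, hom l & forall x, x \in s -> span l x.
  elim: s {sP} => [|x s [l lh ls]]; first by exists [::].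
  have [m mh mx] := span1 x; exists (l ++ m) => [z|z].
    by rewrite mem_cat => /orP[/lh|/mh].
  rewrite inE => zxs S S0 SD SZ Sl.
  case/orP: zxs => [/eqP ->|/ls zl]; [apply: (mx S)|apply: (zl S)] => // y yl;
    by apply: Sl; rewrite mem_cat yl ?orbT.
have /choice[dl dlP] (i : 'I_(size l)) : exists j, dgm_deg j l`_i.
  by apply: lh; exact: mem_nth.
exists (size l), (fun i => l`_i), dl; split=> // x.
pose S x := exists c : 'I_(size l) -> A, x = \sum_i c i *: l`_i.
have S0 : S 0 by exists (fun=> 0); rewrite big1 // => i _; rewrite scale0r.
have SD y z : S y -> S z -> S (y + z).
  move=> [c ->] [d ->]; exists (fun i => c i + d i).
  by rewrite -big_split; apply: eq_bigr => i _; rewrite scalerDl.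
have SZ a y : S y -> S (a *: y).
  move=> [c ->]; exists (fun i => a * c i).
  by rewrite scaler_sumr; apply: eq_bigr => i _; rewrite scalerA.
have [r [c [rs ->]]] := sP x; rewrite big_seq; apply: (@big_ind _ S) => // y yr.
apply/SZ/(ls y (rs y yr) S S0 SD SZ) => z /(nthP 0)[i il <-].
exists (fun j => (j == Ordinal il)%:R).
rewrite (bigD1 (Ordinal il)) //= eqxx scale1r big1 ?addr0 // => j /negPf ->.
by rewrite scale0r.
Qed.

Lemma drop_generator n (e : 'I_n.+1 -> P) (dl : 'I_n.+1 -> int) j
    (b : 'I_n.+1 -> A) :
  hom_gen e dl -> e j = \sum_(i | i != j) b i *: e i ->
  hom_gen (e \o lift j) (dl \o lift j).
Proof.
move=> [ed eg] ej; split=> [i|x]; first exact: ed.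
have [c ->] := eg x; exists (fun i => c j * b (lift j i) + c (lift j i)).
have sumj (F : 'I_n.+1 -> P) : \sum_(i | i != j) F i = \sum_i F (lift j i).
  have E : \sum_i F i = F j + \sum_i F (lift j i) by rewrite (bigD1_ord j).
  by apply: (addrI (F j)); rewrite -E [RHS](bigD1 j).
rewrite (bigD1 j) //= ej scaler_sumr !sumj -big_split; apply: eq_bigr => i _ /=.
by rewrite scalerDl scalerA.
Qed.

Hypothesis connA : connected A.

(** A section s of the free cover gives a matrix M with e = M e. Connectedness makes M triangular
    for the degrees, minimality makes its blocks of equal degree identities, and a relation c
    satisfies c M = 0. *)
Lemma minimal_generators_free n (e : 'I_n -> P) (dl : 'I_n -> int) :
  semi_projective P -> hom_gen e dl ->
  (forall m e' dl', @hom_gen m e' dl' -> (n <= m)%N) ->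
  forall c : 'I_n -> A, \sum_i c i *: e i = 0 -> forall i, c i = 0.
Proof.
move=> projP eh nmin.
have drop j b : e j = \sum_(i | i != j) b i *: e i -> False.
  case: n e dl eh nmin j b => [|m] e' dl' eh nmin j b; first by case: j.
  by move=> /(drop_generator eh)/nmin; rewrite ltnn.
have [ed eg] := eh.
pose phi (v : 'rV[A]_n) : P := \sum_i v 0 i *: e i.
have phiL : linear phi.
  move=> a x y; rewrite /phi scaler_sumr -big_split; apply: eq_bigr => i _.
  by rewrite !mxE scalerDl scalerA.
pose f : {linear 'rV[A]_n -> P} :=
  HB.pack phi (GRing.isLinear.Build _ _ _ _ _ phiL).
have fd m (v : kmod 'rV[A]_n) : free_deg dl m v -> dgm_deg m (f v : kmod P).
  move=> vm; apply: (subspace_sum _ (grading_sub (dgm_grading P) m)).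
  by move=> i _; rewrite -(subrK (dl i) m); exact: dgm_degZ.
have fs m (y : kmod P) : dgm_deg m y ->
    exists2 v : kmod 'rV[A]_n, free_deg dl m v & f v = y.
  move=> ym; have [c yE] := eg y.
  exists (\row_i gproj (dga_grading A) (m - dl i) (c i)) => [i|].
    by rewrite mxE; exact: gproj_deg.
  rewrite -[RHS](gproj_id (dgm_grading P) ym) yE linear_sum /= /phi.
  by apply: eq_bigr => i _; rewrite mxE (gproj_scale _ _ (ed i)).
have [s [sd sK]] := @split_of_semi_projective _ _ P (free_gr A dl) f fd fs projP.
pose M i j : A := (s (e i) : 'rV[A]_n) 0 j.
have Md i j : dga_deg (dl i - dl j) (M i j) by exact: (sd _ _ (ed i)).
have eM i : e i = \sum_j M i j *: e j by rewrite -[LHS]sK.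
have M0 i j : dl i < dl j -> M i j = 0.
  by move=> ij; apply: connA.1 (Md i j); rewrite subr_lt0.
have M1 i j : dl i = dl j -> M i j = (i == j)%:R.
  move=> ij; apply: contrapT => Mij.
  have [c cE] : exists c : k, M i j - (i == j)%:R = c%:A.
    apply: connA.2; have := Md i j; rewrite ij subrr => Mij0.
    rewrite -scaleN1r addrC; apply: (grading_sub (dga_grading A) _).2 => //.
    case: (i == j); first exact: dga_deg1.
    exact: (grading_sub (dga_grading A) _).1.
  have c0 : c != 0.
    apply/eqP => c0; apply: Mij; apply/eqP; rewrite -subr_eq0 cE c0.
    by rewrite scale0r.
  (* Subtracting e_i from its expansion leaves a relation whose coefficient at e_j is the scalar c.
     If c is non-zero, e_j is a combination of the other generators, against minimality. *)
  have z : \sum_l (M i l - (i == l)%:R) *: e l = 0.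
    under eq_bigr do rewrite scalerBl.
    rewrite sumrB -eM (bigD1 i) //= eqxx scale1r big1 ?addr0 ?subrr // => l.
    by rewrite eq_sym => /negPf ->; rewrite scale0r.
  have ej : e j = \sum_(l | l != j) (- (c^-1)%:A * (M i l - (i == l)%:R)) *: e l.
    under eq_bigr do rewrite -scalerA.
    rewrite -scaler_sumr; move: z; rewrite (bigD1 j) //= cE => /eqP.
    rewrite addr_eq0 => /eqP /(congr1 (fun x => (c^-1)%:A *: x)).
    rewrite scalerN scaleNr => <-.
    by rewrite scalerA mulr_algl scalerA mulVf // !scale1r.
  exact: drop ej.
move=> c c0; have cM j : \sum_i c i * M i j = 0.
  have := congr1 (fun x => (s x : 'rV[A]_n) 0 j) c0.
  rewrite linear_sum linear0 summxE [RHS]mxE => E; rewrite -[RHS]E.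
  by apply: eq_bigr => i _; rewrite linearZ mxE.
apply: contrapT => /existsNP[i0 ci0].
have P0 : c i0 != 0 by apply/eqP.
(* For j of largest degree among the indices with c j != 0, column j of c M = 0 reduces to c j =
   0. *)
case: (@Order.TotalTheory.arg_maxP _ _ _ i0 (fun i => c i != 0) dl P0) => j cj jmax.
move: cj; rewrite -(cM j) (bigD1 j) //= M1 // eqxx mulr1 big1 ?addr0 ?eqxx //.
move=> i ij; have [->|ci] := eqVneq (c i) 0; first by rewrite mul0r.
have := jmax i ci; rewrite /= le_eqVlt => /orP[/eqP/M1 ->|/M0 ->].
  by rewrite (negPf ij) mulr0.
by rewrite mulr0.
Qed.

End Generators.

(** * A two-term acyclic module *)

Section Augmentation.
Variables (k : fieldType) (A : dgAlg k).
Hypothesis connA : connected A.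

Lemma algC_inj (c d : k) : c%:A = d%:A :> A -> c = d.
Proof.
move=> /eqP; rewrite -subr_eq0 -scalerBl scaler_eq0 oner_eq0 orbF subr_eq0.
by move=> /eqP.
Qed.

Lemma augmentation_exists : exists eps : {linear A -> k^o},
  forall a : A, gproj (dga_grading A) 0 a = (eps a)%:A.
Proof.
have /choice[eps epsE] (a : A) : exists c : k,
    gproj (dga_grading A) 0 a = c%:A.
  by apply: connA.2; exact: gproj_deg.
have epsL : linear (eps : A -> k^o).
  move=> c a b; apply: algC_inj; rewrite -epsE linearP /= !epsE scalerA.
  by rewrite -[LHS]scalerDl.
pose f : {linear A -> k^o} :=
  HB.pack (eps : A -> k^o) (GRing.isLinear.Build _ _ _ _ _ epsL).
by exists f.
Qed.

Definition aug : {linear A -> k^o} := projT1 (cid augmentation_exists).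

Lemma augE (a : A) : gproj (dga_grading A) 0 a = (aug a)%:A.
Proof. by rewrite /aug; case: cid. Qed.

Let pr1 := gproj (dga_grading A) 1.

Lemma augC (c : k) : aug c%:A = c.
Proof.
apply: algC_inj; rewrite -augE gproj_id //.
exact: subspaceZ (grading_sub (dga_grading A) _) (dga_deg1 A).
Qed.

Lemma pr1C (c : k) : pr1 c%:A = 0.
Proof. by rewrite linearZ /= /pr1 (gproj_neq _ (dga_deg1 A)) ?scaler0. Qed.

Lemma aug_neq i (a : A) : dga_deg i a -> i != 0 -> aug a = 0.
Proof.
move=> ai i0; apply: algC_inj; rewrite -augE scale0r.
by apply: gproj_neq ai _; rewrite eq_sym.
Qed.

(** Modulo its part of degree at least 2, A is a square-zero extension of k by A^1; hence the
    projection to A^1 is a derivation along the augmentation. These identities make [two_term] a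
    module. *)
Lemma aug_pr1M (a b : A) : aug (a * b) = aug a * aug b /\
  pr1 (a * b) = aug a *: pr1 b + aug b *: pr1 a.
Proof.
move: a; apply: (grading_ind (dga_grading A)) => [|a a' [aE aF] [a'E a'F]|i a ai].
- by rewrite mul0r !linear0 mul0r scale0r ?scaler0 addr0.
- rewrite mulrDl !linearD aE a'E aF a'F mulrDl scalerDl.
  by rewrite addrACA.
move: b; apply: (grading_ind (dga_grading A)) => [|b b' [bE bF] [b'E b'F]|j b bj].
- by rewrite mulr0 !linear0 mulr0 scale0r ?scaler0 addr0.
- rewrite mulrDr !linearD bE b'E bF b'F mulrDr scalerDl.
  by rewrite addrACA.
have [i0|i0|i0] := ltgtP i 0.
- by rewrite (connA.1 _ _ i0 ai) mul0r !linear0 mul0r scale0r ?scaler0 addr0.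
- have [j0|j0|j0] := ltgtP j 0.
  + by rewrite (connA.1 _ _ j0 bj) mulr0 !linear0 mulr0 scale0r ?scaler0 addr0.
  + have abd := dga_degM ai bj.
    rewrite (aug_neq abd) ?(aug_neq ai) ?(aug_neq bj) ?mul0r ?scale0r ?addr0; try lia.
    by split=> //; apply: gproj_neq abd _; lia.
  + rewrite j0 in bj; have [c ->] := connA.2 _ bj.
    rewrite augC pr1C scaler0 add0r mulr_algr !linearZ /=.
    by rewrite [c *: _]mulrC.
- rewrite i0 in ai; have [c ->] := connA.2 _ ai.
  by rewrite augC pr1C scaler0 addr0 mulr_algl !linearZ.
Qed.

Section TwoTerm.
Variables (n : nat) (b : int) (f : 'I_n -> {linear ('I_n -> A) -> k^o}).

(* Two copies of k^n, in degrees b and b + 1. A acts on each through its       *)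
(* augmentation, and A^1 maps the first copy to the second one through f.      *)
Definition two_term : Type := ('rV[k]_n * 'rV[k]_n)%type.
HB.instance Definition _ := GRing.Zmodule.copy two_term ('rV[k]_n * 'rV[k]_n)%type.

Definition rho (a : A) (x : 'rV[k]_n) : 'rV[k]_n :=
  \row_l f l (fun j => x 0 j *: pr1 a).

Lemma rhoDl a a' x : rho (a + a') x = rho a x + rho a' x.
Proof.
apply/rowP => l; rewrite !mxE -linearD; congr (f l _); apply/funext => j.
by rewrite linearD scalerDr.
Qed.

Lemma rhoDr a x x' : rho a (x + x') = rho a x + rho a x'.
Proof.
apply/rowP => l; rewrite !mxE -linearD; congr (f l _); apply/funext => j.
by rewrite mxE scalerDl.
Qed.

Lemma rhoZr a c x : rho a (c *: x) = c *: rho a x.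
Proof.
apply/rowP => l; rewrite !mxE -[RHS]linearZ; congr (f l _); apply/funext => j.
by rewrite mxE -scalerA.
Qed.

Lemma rho0 a : rho a 0 = 0.
Proof. by have := rhoZr a 0 0; rewrite !scale0r. Qed.

Lemma rho_pr1 a x : pr1 a = 0 -> rho a x = 0.
Proof.
move=> a0; apply/rowP => l; rewrite !mxE -(linear0 (f l)); congr (f l _).
by apply/funext => j; rewrite a0 scaler0.
Qed.

Lemma rhoM a a' x : rho (a * a') x = aug a *: rho a' x + rho a (aug a' *: x).
Proof.
apply/rowP => l; rewrite !mxE -[_ * f l _]linearZ -linearD; congr (f l _).
apply/funext => j; rewrite !fctE (aug_pr1M a a').2 mxE scalerDr !scalerA.
by congr (_ + _); rewrite mulrC.
Qed.

Definition two_term_scale (a : A) (p : two_term) : two_term :=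
  (aug a *: p.1, aug a *: p.2 + rho a p.1).

Fact two_term_scalerA (a a' : A) p :
  two_term_scale a (two_term_scale a' p) = two_term_scale (a * a') p.
Proof.
by congr (_, _); rewrite /= (aug_pr1M a a').1 ?rhoM ?scalerDr ?scalerA ?addrA.
Qed.

Fact two_term_scale1r : left_id 1 two_term_scale.
Proof.
move=> [x y]; have -> : (1 : A) = 1%:A by rewrite scale1r.
by rewrite /two_term_scale augC rho_pr1 ?pr1C //= !scale1r addr0.
Qed.

Fact two_term_scalerDr : right_distributive two_term_scale +%R.
Proof.
move=> a [x y] [x' y']; congr (_, _); rewrite /= !scalerDr // rhoDr.
by rewrite addrACA.
Qed.

Fact two_term_scalerDl x : {morph two_term_scale^~ x : a a' / a + a'}.
Proof.
move=> a a'; congr (_, _); rewrite /= linearD !scalerDl // rhoDl.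
by rewrite addrACA.
Qed.

HB.instance Definition _ := GRing.Zmodule_isLmodule.Build A two_term
  two_term_scalerA two_term_scale1r two_term_scalerDr two_term_scalerDl.

Lemma two_term_scaleE (a : A) (p : two_term) :
  a *: p = (aug a *: p.1, aug a *: p.2 + rho a p.1).
Proof. by []. Qed.

Lemma two_term_kscaleE (c : k) (p : kmod two_term) :
  c *: p = (c *: p.1, c *: p.2).
Proof. by rewrite kmodE two_term_scaleE augC rho_pr1 ?pr1C ?addr0. Qed.

Definition two_term_deg (m : int) (p : kmod two_term) : Prop :=
  (m != b -> p.1 = 0) /\ (m != b + 1 -> p.2 = 0).

Fact two_term_grading : grading two_term_deg.
Proof.
apply: (@grading_of_proj _ _ _ (fun m (p : kmod two_term) =>
  (if m == b then p.1 else 0, if m == b + 1 then p.2 else 0))).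
- move=> m; split=> [|c [x y] [x' y'] [/= x0 y0] [/= x'0 y'0]] //.
  rewrite two_term_kscaleE; split=> /= mb.
    by rewrite x0 // x'0 // scaler0 addr0.
  by rewrite y0 // y'0 // scaler0 addr0.
- move=> m [x y] [x' y']; congr (_, _) => /=.
    by case: ifP; rewrite ?addr0.
  by case: ifP; rewrite ?addr0.
- by move=> m [x y]; split => /= /negPf ->.
- move=> m [x y] [/= x0 y0]; congr (_, _).
    by case: eqP => // /eqP/x0.
  by case: eqP => // /eqP/y0.
- move=> m j [x y] [/= x0 y0] mj; congr (_, _).
    by case: eqP => // mb; apply: x0; rewrite -mb eq_sym.
  by case: eqP => // mb; apply: y0; rewrite -mb eq_sym.
move=> Q Q0 QD Qd [x y]; have -> : (x, y) = (x, 0) + (0, y) :> kmod two_term.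
  by congr (_, _); rewrite ?addr0 ?add0r.
by apply: (QD); [apply: (Qd b)|apply: (Qd (b + 1))]; split => //=; rewrite eqxx.
Qed.

Definition two_term_d_fun (p : kmod two_term) : kmod two_term := (0, p.1).

Fact two_term_d_linear : linear two_term_d_fun.
Proof.
move=> c p q; rewrite /two_term_d_fun !two_term_kscaleE.
by congr (_, _); rewrite /= scaler0 addr0.
Qed.

HB.instance Definition _ := GRing.isLinear.Build k (kmod two_term) (kmod two_term) _
  two_term_d_fun two_term_d_linear.

Fact two_term_degZ i j (a : A) (p : two_term) :
  dga_deg i a -> two_term_deg j p -> two_term_deg (i + j) (a *: p).
Proof.
move=> ai [x0 y0]; split=> /= ij.
  have [i0|i0] := eqVneq i 0; last by rewrite (aug_neq ai) ?scale0r.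
  by rewrite x0 ?scaler0 //; move: ij; rewrite i0 add0r.
have -> : aug a *: p.2 = 0.
  have [i0|i0] := eqVneq i 0; last by rewrite (aug_neq ai) ?scale0r.
  by rewrite y0 ?scaler0 //; move: ij; rewrite i0 add0r.
have [i1|i1] := eqVneq i 1.
  rewrite x0; last by apply: contra_neq ij; lia.
  by rewrite rho0 addr0.
by rewrite rho_pr1 ?addr0 //; apply: gproj_neq ai _; rewrite eq_sym.
Qed.

Fact two_term_d_deg i p : two_term_deg i p -> two_term_deg (i + 1) (two_term_d_fun p).
Proof. by move=> [x0 y0]; split=> //= ib; apply: x0; apply: contra_neq ib; lia. Qed.

Fact two_term_dd p : two_term_d_fun (two_term_d_fun p) = 0.
Proof. by []. Qed.

(** Both [aug] and [pr1] kill da, since A vanishes in degree -1 and d vanishes on A^0 = k. What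
    remains is non-zero only for |a| = 0, where there is no sign. *)
Fact two_term_leibniz i (a : A) (p : two_term) : dga_deg i a ->
  two_term_d_fun (a *: p) = (dga_d A a *: p : kmod two_term)
      + ksign k i *: (a *: (two_term_d_fun p : two_term) : kmod two_term).
Proof.
move=> ai; rewrite /two_term_d_fun two_term_kscaleE !two_term_scaleE /=.
have dai := dga_d_deg ai.
have d0 : aug (dga_d A a) = 0.
  have [i1|i1] := eqVneq i (-1); last by apply: (aug_neq dai); lia.
  by rewrite (connA.1 _ _ _ ai) ?linear0 // i1.
have r0 x : rho (dga_d A a) x = 0.
  apply: rho_pr1; have [i0|i0] := eqVneq i 0; last by apply: (gproj_neq _ dai); lia.
  rewrite i0 in ai; have [c ->] := connA.2 _ ai.
  by rewrite dga_dC linear0.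
rewrite d0 r0 rho0 !scale0r !scaler0 !addr0.
apply: injective_projections; rewrite /= ?add0r ?addr0 //.
have [i0|i0] := eqVneq i 0; first by rewrite i0 ksign0 scale1r.
by rewrite (aug_neq ai) // !scale0r scaler0.
Qed.

Definition two_term_dg : dgMod A :=
  DGMod two_term_grading two_term_degZ two_term_d_deg two_term_dd two_term_leibniz.

Lemma two_term_acyclic : acyclic two_term_dg.
Proof.
move=> i [x y] [[/= _ y0] /(congr1 snd) /= x0]; exists (y, 0); split.
  by split=> //= ib; apply: y0; apply: contra_neq ib; lia.
by congr (_, _); exact/esym.
Qed.

End TwoTerm.
End Augmentation.

(** * Hom complexes into acyclic modules *)

Section HomAcyclic.
Variables (k : fieldType) (A : dgAlg k).

Lemma Hom_acyclic (P K : dgMod A) : semi_projective P -> acyclic K ->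
  forall i (f : Hom_cpx P K), cocycle i f -> coboundary i f.
Proof.
move=> projP acK.
(* The zero DG module. The map K -> Z is a surjective quasi-isomorphism, and injectivity of the
   induced map on cohomology of Hom complexes is the claim. *)
pose Z := coind_dg (free_gr A (fun i : 'I_0 => 0)).
have Z0 (x y : kmod Z) : x = y.
  case: x y => [x x'] [y y'].
  by congr (_, _); apply/rowP; case.
pose g : dgm_cpx K -> dgm_cpx Z := fun=> 0.
have gm : dg_morphism g by split=> [|x]; [exact: (Ahom_sub K Z 0).1|exact: Z0].
have gs : deg_surjective g.
  move=> i y _; exists 0; split; first exact: (grading_sub (dgm_grading K) i).1.
  exact: Z0.
have [_ [_ inj _]] := projP _ _ g gm gs
  (acyclic_quasi_iso acK (@coind_acyclic _ _ _) gm).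
move=> i f fc; apply: inj => //; exists 0; split; first exact: (Ahom_sub P Z _).1.
by apply/funext => x; exact: Z0.
Qed.

End HomAcyclic.

(** * Homogeneous bases *)

Section FreeBasis.
Variables (k : fieldType) (A : dgAlg k) (P : dgMod A).

Definition free_basis n (e : 'I_n -> P) (dl : 'I_n -> int) : Prop :=
  hom_gen e dl /\
  (forall c : 'I_n -> A, \sum_i c i *: e i = 0 -> forall i, c i = 0).

Definition gspan n (e : 'I_n -> P) (Q : pred 'I_n) (x : P) : Prop :=
  exists2 c : 'I_n -> A, (forall i, ~~ Q i -> c i = 0) & x = \sum_i c i *: e i.

Section Coordinates.
Variables (n : nat) (e : 'I_n -> P) (dl : 'I_n -> int).
Hypothesis fb : free_basis e dl.

Definition bcoord (x : P) : 'I_n -> A := projT1 (cid (fb.1.2 x)).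

Lemma bcoordE x : x = \sum_i bcoord x i *: e i.
Proof. by rewrite /bcoord; case: cid. Qed.

Lemma bcoord_uniq (c : 'I_n -> A) x : x = \sum_i c i *: e i -> bcoord x =1 c.
Proof.
move=> xE i; apply/eqP; rewrite -subr_eq0; apply/eqP; move: i; apply: fb.2.
under eq_bigr do rewrite scalerBl.
by rewrite sumrB -bcoordE -xE subrr.
Qed.

Lemma bcoordD x y i : bcoord (x + y) i = bcoord x i + bcoord y i.
Proof.
apply: (bcoord_uniq (c := fun i => bcoord x i + bcoord y i)).
under eq_bigr do rewrite scalerDl.
by rewrite big_split -!bcoordE.
Qed.

Lemma bcoordZ a x i : bcoord (a *: x) i = a * bcoord x i.
Proof.
apply: (bcoord_uniq (c := fun i => a * bcoord x i)).
under eq_bigr do rewrite -scalerA.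
by rewrite -scaler_sumr -bcoordE.
Qed.

Lemma bcoord0 i : bcoord 0 i = 0.
Proof. by have := bcoordZ 0 0 i; rewrite scale0r mul0r. Qed.

Lemma bcoord_sum I (r : seq I) (Q : pred I) (F : I -> P) i :
  bcoord (\sum_(j <- r | Q j) F j) i = \sum_(j <- r | Q j) bcoord (F j) i.
Proof. exact: (big_morph _ (fun x y => bcoordD x y i) (bcoord0 i)). Qed.

Lemma bcoord_basis j i : bcoord (e j) i = (j == i)%:R.
Proof.
apply: (bcoord_uniq (c := fun i => (j == i)%:R)).
rewrite (bigD1 j) //= eqxx scale1r big1 ?addr0 // => l.
by rewrite eq_sym => /negPf ->; rewrite scale0r.
Qed.

Lemma bcoord_deg m x i : dgm_deg m x -> dga_deg (m - dl i) (bcoord x i).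
Proof.
move=> xm; suff /bcoord_uniq -> :
  x = \sum_j gproj (dga_grading A) (m - dl j) (bcoord x j) *: e j.
  exact: gproj_deg.
rewrite -[LHS](gproj_id (dgm_grading P) xm) {1}[x]bcoordE linear_sum /=.
by apply: eq_bigr => j _; rewrite (gproj_scale _ _ (fb.1.1 j)).
Qed.

Lemma gspan_bcoord (Q : pred 'I_n) x :
  (forall i, ~~ Q i -> bcoord x i = 0) -> gspan e Q x.
Proof. by move=> x0; exists (bcoord x) => //; exact: bcoordE. Qed.

(** The sign condition holds for even m and makes the extension plainly A-linear; the cases needed
    are m = 0 and m = -2. *)
Lemma Ahom_extend (N : dgMod A) (m : int) (v : 'I_n -> N) :
  (forall j, ksign k (m * j) = 1) -> (forall i, dgm_deg (dl i + m) (v i)) ->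
  exists2 f : kmod P -> kmod N, Ahom m f & forall i, f (e i) = v i.
Proof.
move=> m1 vd; pose f (x : P) : N := \sum_i bcoord x i *: v i.
have fD x y : f (x + y) = f x + f y.
  by rewrite -big_split; apply: eq_bigr => i _; rewrite bcoordD scalerDl.
have fZ a x : f (a *: x) = a *: f x.
  by rewrite scaler_sumr; apply: eq_bigr => i _; rewrite bcoordZ scalerA.
exists f => [|i]; last first.
  rewrite /f (bigD1 i) //= bcoord_basis eqxx scale1r big1 ?addr0 // => j ij.
  by rewrite bcoord_basis eq_sym (negPf ij) scale0r.
split=> [c x y|j x xj|j a x aj].
- by rewrite !kmodE fD fZ.
- apply: (subspace_sum _ (grading_sub (dgm_grading N) _)) => i _.
  have -> : j + m = (j - dl i) + (dl i + m) by lia.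
  by apply: dgm_degZ => //; exact: bcoord_deg.
- by rewrite m1 scale1r fZ.
Qed.

Section Exchange.
Variables (j : 'I_n) (x : P) (c : k).
Hypotheses (c0 : c != 0) (xd : dgm_deg (dl j) x) (xj : bcoord x j = c%:A).

Definition exchange i := if i == j then x else e i.

Lemma exchange_free_basis : free_basis exchange dl.
Proof.
have exch (b : 'I_n -> A) : \sum_i b i *: exchange i =
    \sum_i (b j * bcoord x i + (if i == j then 0 else b i)) *: e i.
  under [RHS]eq_bigr do rewrite scalerDl -scalerA.
  rewrite big_split -scaler_sumr -bcoordE (bigD1 j) //= /exchange eqxx.
  congr (_ + _); rewrite [RHS](bigD1 j) //= eqxx scale0r add0r.
  by apply: eq_bigr => i /negPf ->.
split; first split=> [i|y].
- by rewrite /exchange; case: eqP => [->|_] //; exact: fb.1.1.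
- pose b i := if i == j then c^-1 *: bcoord y j
    else bcoord y i - (c^-1 *: bcoord y j) * bcoord x i.
  exists b; rewrite exch [LHS]bcoordE; apply: eq_bigr => i _.
  rewrite /b eqxx; case: eqP => [->|_]; last by rewrite addrC subrK.
  by rewrite xj mulr_algr scalerA mulfV // scale1r addr0.
- move=> b; rewrite exch => /(fb.2) b0.
  have bj : b j = 0.
    have := b0 j; rewrite eqxx addr0 xj mulr_algr => /eqP.
    by rewrite scaler_eq0 (negPf c0) => /eqP.
  by move=> i; have := b0 i; rewrite bj mul0r add0r; case: eqP => // ->.
Qed.

Lemma exchange_gspan (Q : pred 'I_n) y : ~~ Q j -> gspan e Q y -> gspan exchange Q y.
Proof.
move=> Qj [b b0 ->]; exists b => //; apply: eq_bigr => i _.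
by rewrite /exchange; case: eqP => // ->; rewrite b0 // !scale0r.
Qed.

End Exchange.
End Coordinates.

Lemma gspanS n (e : 'I_n -> P) (Q Q' : pred 'I_n) x :
  (forall i, Q i -> Q' i) -> gspan e Q x -> gspan e Q' x.
Proof.
move=> QQ [c c0 ->]; exists c => // i Qi; apply: c0.
by apply: contraNN Qi; exact: QQ.
Qed.

Lemma Ahom_gspan0 n (e : 'I_n -> P) (Q : pred 'I_n) (N : dgMod A) m
    (f : kmod P -> kmod N) :
  Ahom m f -> (forall i, Q i -> f (e i) = 0) -> forall x, gspan e Q x -> f x = 0.
Proof.
move=> [fL _ fA] fe x [c cQ ->].
have fD x' y : f (x' + y) = f x' + f y by rewrite -[x']scale1r fL !scale1r.
have f0 : f 0 = 0 by apply/(addIr (f 0)); rewrite -fD !add0r.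
rewrite (big_morph _ fD f0) big1 // => i _.
have [Qi|/cQ ->] := boolP (Q i); last by rewrite scale0r.
move: (c i); apply: (grading_ind (dga_grading A)) => [|a b aE bE|j a aj].
- by rewrite scale0r.
- by rewrite scalerDl fD aE bE addr0.
- by rewrite (fA _ _ _ aj) fe // !scaler0.
Qed.

(** The bound on [rk] ends the induction on ranks in [hom_d_vanishing] and leaves the rank #|T| free
    for the next generator. In rank 0 the span is zero, so d vanishes there. *)
Definition filtered n (e : 'I_n -> P) (dl : 'I_n -> int) (T : {set 'I_n})
    (rk : 'I_n -> nat) : Prop :=
  [/\ free_basis e dl, forall i, i \in T -> (rk i < #|T|)%N
    & forall i, i \in T ->
        gspan e (fun j => (j \in T) && (rk j < rk i)%N) (dgm_d P (e i))].

Lemma filtered_gspan n (e : 'I_n -> P) dl T rk : filtered e dl T rk ->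
  forall i, i \in T -> gspan e (mem T) (dgm_d P (e i)).
Proof. by move=> [_ _ Td] i /Td; apply: gspanS => j /andP[]. Qed.

(** Once h' kills the ranks below m, it sends each e_i of rank m with i in T to a cocycle of K,
    hence to some dv. Subtracting the boundary of the degree -2 map e_i -> v kills rank m too, and
    leaves dh + hd unchanged. *)
Lemma hom_d_vanishing n (e : 'I_n -> P) dl T rk (K : dgMod A)
    (h : kmod P -> kmod K) :
  filtered e dl T rk -> acyclic K -> Ahom (- 1) h ->
  (forall i, i \in T -> hom_d (- 1) h (e i) = 0) ->
  exists h', [/\ Ahom (- 1) h', hom_d (- 1) h' = hom_d (- 1) h
    & forall i, i \in T -> h' (e i) = 0].
Proof.
move=> [fb rkT dT] acK hA hT.
suff [h' [h'A h'd h'0]] : exists h', [/\ Ahom (- 1) h',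
    hom_d (- 1) h' = hom_d (- 1) h
    & forall i, i \in T -> (rk i < #|T|)%N -> h' (e i) = 0].
  by exists h'; split=> // i iT; exact/h'0/rkT.
elim: #|T| => [|m [h' [h'A h'd h'0]]]; first by exists h.
have h'dT i : i \in T -> rk i = m -> h' (dgm_d P (e i)) = 0.
  move=> iT im; apply: (Ahom_gspan0 h'A) (dT i iT) => j /andP[jT].
  by rewrite im; exact: h'0.
(* The value 0 away from rank m keeps the lower ranks killed. *)
have /choice[v vP] i : exists v : kmod K, dgm_deg (dl i - 2) v /\
    if (i \in T) && (rk i == m) then dgm_d K v = h' (e i) else v = 0.
  have [/andP[iT /eqP im]|_] := boolP (_ && _); last first.
    by exists 0; split=> //; exact: (grading_sub (dgm_grading K) _).1.
  have [|v [vd vE]] := acK (dl i - 1) (h' (e i)).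
    split; first by have [_ h'deg _] := h'A; exact: h'deg (fb.1.1 i).
    have := hT i iT; rewrite -h'd /hom_d h'dT // scaler0 subr0; exact.
  by exists v; split=> //; move: vd; rewrite -addrA.
have sgn2 j : ksign k (- 2 * j) = 1.
  by rewrite /ksign -signr_odd abszM oddM.
have [h2 h2A h2e] := Ahom_extend fb sgn2 (fun i => (vP i).1).
exists (h' - hom_d (- 2) h2); split.
- have [_ /(_ (- 1 : k) _ _ (hom_d_deg h2A) h'A)] := Ahom_sub P K (- 1).
  by rewrite scaleN1r addrC.
- have := @hom_dP _ _ P K (- 1) (- 1) _ _ (hom_d_deg h2A) h'A.
  have := hom_dd h2A; rewrite /= => ->.
  by rewrite scaler0 add0r scaleN1r addrC => ->.
move=> i iT; rewrite ltnS leq_eqVlt => im.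
have h2d : h2 (dgm_d P (e i)) = 0.
  apply: (Ahom_gspan0 h2A) (dT i iT) => j /andP[jT ji].
  rewrite h2e; have [_] := vP j; rewrite jT ltn_eqF //=.
  by case/orP: im => [/eqP <-|im] //; exact: ltn_trans im.
rewrite !fctE /hom_d h2d scaler0 subr0 h2e; have [_] := vP i; rewrite iT /=.
case/orP: im => [/eqP im|im]; first by rewrite im eqxx => ->; rewrite subrr.
by rewrite ltn_eqF // => ->; rewrite linear0 subr0 h'0.
Qed.

End FreeBasis.

(** * Enlarging the semi-free part *)

Section Enlarging.
Variables (k : fieldType) (A : dgAlg k).
Hypothesis connA : connected A.
Variable P : dgMod A.
Hypothesis projP : semi_projective P.

Section Step.
Variables (n : nat) (e : 'I_n -> P) (dl : 'I_n -> int) (T : {set 'I_n})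
  (rk : 'I_n -> nat).
Hypothesis filtT : filtered e dl T rk.

Let fb : free_basis e dl := let: And3 fb _ _ := filtT in fb.
Let dcoef i := bcoord fb (dgm_d P (e i)).

Lemma dcoef_deg i j : dga_deg (dl i + 1 - dl j) (dcoef i j).
Proof. exact/bcoord_deg/dgm_d_deg/fb.1.1. Qed.

(* Excludes that the differential modulo the span of T is minimal, but        *)
(* injective on the component of lowest degree, whose basis is indexed by I.  *)
Lemma no_cycle_contradiction (b : int) (I : pred 'I_n) (i0 : 'I_n) :
  (forall i, I i -> i \notin T /\ dl i = b) -> I i0 ->
  (forall i, i \notin T -> ~~ I i -> b < dl i) ->
  (forall i j, i \notin T -> j \notin T -> dl i + 1 = dl j -> dcoef i j = 0) ->
  (forall c : 'I_n -> k, (forall i, ~~ I i -> c i = 0) ->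
    (forall j, I j -> \sum_i c i *: dcoef i j = 0) -> forall i, c i = 0) ->
  False.
Proof.
move=> IT Ii0 Ib Dmin Dfree.
have dcoef_gt i j : I i -> j \notin T -> ~~ I j -> dcoef i j = 0.
  move=> Ii jT jI; have [iT ib] := IT i Ii; have bj := Ib j jT jI.
  have [ij|ij] := eqVneq (dl i + 1) (dl j); first exact: Dmin.
  by apply: connA.1 (dcoef_deg i j); lia.
(* Row i of the differential, cut to the columns in I. By [Dfree] the rows with i in I are linearly
   independent over k, so they have dual functionals f; these form the retraction of d. *)
pose a i : 'I_n -> A := fun j => if I j then dcoef i j else 0.
have /choice[f fP] l : exists f : {linear ('I_n -> A) -> k^o},
    forall i, I i -> f (a i) = (i == l)%:R.
  have [Il|Il] := boolP (I l); last first.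
    exists \0 => i Ii /=; case: eqP => // il.
    by rewrite il (negPf Il) in Ii.
  pose S (v : 'I_n -> A) := exists c : 'I_n -> k,
    v = \sum_(i | I i && (i != l)) c i *: a i.
  have SS : subspace S.
    split; first by exists (fun=> 0); rewrite big1 // => i _; rewrite scale0r.
    move=> c x y [c1 ->] [c2 ->]; exists (fun i => c * c1 i + c2 i).
    rewrite scaler_sumr -big_split; apply: eq_bigr => i _ /=.
    by rewrite scalerA scalerDl.
  have [|f [fS fl]] := linear_functional SS (v := a l).
    move=> [c al].
    (* If row l were a combination of the others, the coefficient -1 at l would give a non-trivial
       relation. *)
    pose c' i := if i == l then -1 else if I i then c i else 0.
    have c'0 i : ~~ I i -> c' i = 0.
      by rewrite /c'; case: eqP => [->|_ /negPf->//]; rewrite Il.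
    have c's j : I j -> \sum_i c' i *: dcoef i j = 0.
      move=> Ij; rewrite (bigD1 l) //= {1}/c' eqxx scaleN1r.
      have := congr1 (fun g => g j) al; rewrite {1}/a Ij fct_sumE => ->.
      rewrite big_mkcondl -sumrN -big_split big1 //= => i il.
      rewrite /c' (negPf il) /a; case: ifP => _; last by rewrite scale0r oppr0 addr0.
      by rewrite !fctE Ij addNr.
    have := Dfree c' c'0 c's l; rewrite /c' eqxx => /eqP.
    by rewrite oppr_eq0 oner_eq0.
  exists f => i Ii; case: eqP => [->//|/eqP il]; apply: fS.
  exists (fun j => (j == i)%:R); rewrite (bigD1 i) /= ?Ii // eqxx scale1r.
  by rewrite big1 ?addr0 // => j /andP[_ /negPf ->]; rewrite scale0r.
pose K := two_term_dg connA b f.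
pose u i : 'rV[k]_n := delta_mx 0 i.
pose v i : K := if I i then (u i, 0) else 0.
have [||p pA pe] := @Ahom_extend _ _ _ _ _ _ fb K 0 v _.
- by move=> j; rewrite mul0r.
- move=> i; rewrite addr0 /v; case: ifP => [Ii|_].
    by have [_ ->] := IT i Ii; split; rewrite ?eqxx.
  exact: (grading_sub (dgm_grading K) _).1.
have pAl : forall (a : A) x, p (a *: x) = a *: p x.
  by apply: (Ahom_general pA) => j; rewrite mul0r.
have [pL _ _] := pA.
have pD x y : p (x + y) = p x + p y by rewrite -[x]scale1r pL !scale1r.
have p0 : p 0 = 0 by apply/(addIr (p 0)); rewrite -pD !add0r.
have pk c x : p (c *: x) = c *: p x by rewrite -[_ *: x]addr0 pL p0 addr0.
have p_sum x : p x = \sum_j bcoord fb x j *: (p (e j) : K).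
  rewrite {1}(bcoordE fb x) (big_morph _ pD p0).
  by apply: eq_bigr => j _; rewrite pAl.
(* For i in T both sides vanish. For i outside T and I, the coefficients on I have degree at least 2
   and act on K as zero. For i in I, the coefficients on I have degree 1 and the claim is the
   duality [fP]. *)
have pd_e i : p (dgm_d P (e i)) = dgm_d K (p (e i)).
  have [iT|iT] := boolP (i \in T).
    rewrite [in RHS]pe /v; case: ifP => [/IT[]|_]; first by rewrite iT.
    rewrite linear0; apply: Ahom_gspan0 pA _ _ (filtered_gspan filtT iT) => j jT.
    by rewrite pe /v; case: ifP => // /IT[]; rewrite [_ \in _]jT.
  have [Ii|Ii] := boolP (I i); last first.
    rewrite [in RHS]pe /v (negPf Ii) linear0 p_sum big1 // => j _; rewrite pe /v.
    case: ifP => [Ij|_]; last by rewrite scaler0.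
    have [_ jb] := IT j Ij; have ib := Ib i iT Ii; have Dij := dcoef_deg i j.
    apply: injective_projections; rewrite /= ?scaler0 ?add0r.
      by rewrite (aug_neq connA Dij) ?scale0r //; lia.
    by apply: rho_pr1; apply: (gproj_neq _ Dij); lia.
  rewrite [in RHS]pe /v Ii p_sum.
  pose w j : 'rV[k]_n := if I j then rho f (dcoef i j) (u j) else 0.
  have D1 j : I j -> dga_deg 1 (dcoef i j).
    move=> Ij; have := dcoef_deg i j; have [_ ->] := IT i Ii; have [_ ->] := IT j Ij.
    by rewrite addrAC subrr add0r.
  have wE j : bcoord fb (dgm_d P (e i)) j *: (p (e j) : K) = (0, w j) :> K.
    rewrite pe /v /w; case: ifP => Ij; last by rewrite scaler0.
    apply: injective_projections; rewrite /= ?scaler0 ?add0r //.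
    by rewrite (aug_neq connA (D1 j Ij)) ?scale0r.
  rewrite (eq_bigr _ (fun j _ => wE j)).
  have wD x y : (0, x + y) = (0, x) + (0, y) :> K by congr (_, _); rewrite addr0.
  rewrite -(big_morph (fun x => (0, x) : K) wD (erefl _)); congr (_, _) => /=.
  apply/rowP => l; rewrite summxE mxE eqxx /= eq_sym -(fP l i Ii).
  have -> : a i = \sum_j (fun j' => if I j then (u j) 0 j' *: dcoef i j else 0).
    apply/funext => j; rewrite fct_sumE (bigD1 j) //= big1 ?addr0.
      by rewrite /a mxE !eqxx scale1r.
    by move=> j' jj'; rewrite mxE eq_sym (negPf jj') scale0r if_same.
  rewrite linear_sum; apply: eq_bigr => j _; rewrite /w.
  case: ifP => Ij; last by rewrite mxE linear0.
  rewrite mxE; congr (f l _); apply/funext => j'.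
  by rewrite gproj_id //; exact: D1.
have pd x : p (dgm_d P x) = dgm_d K (p x).
  rewrite (bcoordE fb x) !(linear_sum, big_morph _ pD p0) /=.
  apply: eq_bigr => i _; move: (bcoord fb x i).
  apply: (grading_ind (dga_grading A)) => [|c c' cE c'E|j c cj].
  - by rewrite !scale0r p0 !linear0.
  - by rewrite !scalerDl !linearD !pD !linearD cE c'E.
  rewrite (dgm_leibniz _ cj) pAl (@dgm_leibniz _ _ K _ _ (p (e i)) cj) pD pk !pAl.
  by rewrite pd_e.
have pcyc : cocycle 0 (p : Hom_cpx P K).
  by split=> //; apply/funext => x; rewrite /= /hom_d scale1r pd subrr.
have [h [hA hp]] := Hom_acyclic projP (@two_term_acyclic _ _ connA _ b f) pcyc.
rewrite sub0r in hA hp.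
have [|h' [h'A h'p h'T]] :=
  hom_d_vanishing filtT (@two_term_acyclic _ _ connA _ b f) hA.
  move=> i iT; have /= -> := hp; rewrite pe /v; case: ifP => // /IT[].
  by rewrite iT.
(* K has no component of degree b - 1. *)
have h'I i : I i -> h' (e i) = 0.
  move=> /IT[_ ib]; have [_ /(_ _ _ (fb.1.1 i)) [/= h1 h2] _] := h'A.
  by apply: injective_projections; [apply: h1|apply: h2]; lia.
(* The differential of e_i0 lies in the span of T and I, where h' vanishes; so dh' + h'd is zero at
   e_i0, while p is not. *)
have h'd : h' (dgm_d P (e i0)) = 0.
  apply: (Ahom_gspan0 (Q := fun j => (j \in T) || I j) h'A (e := e)) => [j|].
    by case/orP => [/h'T|/h'I].
  apply: (gspan_bcoord (fb := fb)) => j; rewrite negb_or => /andP[jT jI].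
  exact: dcoef_gt.
have /= := congr1 (fun g => g (e i0)) (etrans h'p hp).
rewrite /hom_d h'd scaler0 subr0 h'I // linear0 pe /v Ii0.
move=> /(congr1 (fun q : two_term k n => q.1 0 i0)) /=.
by rewrite !mxE !eqxx => /esym/eqP; rewrite oner_eq0.
Qed.

(** If some d e_i has an invertible coordinate outside T, it is itself the new generator, with zero
    differential. Otherwise [no_cycle_contradiction] forces a cycle modulo the span of T in the
    lowest remaining degree. *)
Lemma new_generator i0 : i0 \notin T -> exists x j (c : k),
  [/\ j \notin T, c != 0, dgm_deg (dl j) x, bcoord fb x j = c%:A
    & gspan e (mem T) (dgm_d P x)].
Proof.
move=> i0T.
have [[i [j [iT jT ij Dij]]]|nmin] := pselect (exists i j,
    [/\ i \notin T, j \notin T, dl i + 1 = dl j & dcoef i j <> 0]).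
  have [c cE] : exists c : k, dcoef i j = c%:A.
    by apply: connA.2; have := dcoef_deg i j; rewrite ij subrr.
  exists (dgm_d P (e i)), j, c; split=> //.
  - by apply/eqP => c0; apply: Dij; rewrite cE c0 scale0r.
  - by rewrite -ij; exact/dgm_d_deg/fb.1.1.
  - by rewrite dgm_dd; apply: (gspan_bcoord (fb := fb)) => l _; exact: bcoord0.
have Dmin i j : i \notin T -> j \notin T -> dl i + 1 = dl j -> dcoef i j = 0.
  by move=> iT jT ij; apply: contrapT => Dij; apply: nmin; exists i, j.
case: (@arg_minP _ _ _ i0 (fun i => i \notin T) dl i0T) => i1 i1T i1min.
pose I i := (i \notin T) && (dl i == dl i1).
have IT i : I i -> i \notin T /\ dl i = dl i1 by move=> /andP[? /eqP].
have Ib i : i \notin T -> ~~ I i -> dl i1 < dl i.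
  by move=> iT; rewrite /I iT /= => ii1; rewrite lt_neqAle eq_sym ii1; exact: i1min.
apply: contrapT => nex.
apply: (@no_cycle_contradiction (dl i1) I i1) => // [|c cI cD i].
  by rewrite /I i1T eqxx.
apply: contrapT => ci; apply: nex.
have iI : I i by apply: contrapT => /negP /cI.
have [iT ib] := IT i iI.
(* The combination given by a non-trivial relation between rows. The coordinates of dx in I vanish
   by [cD], those outside T and I by [Dmin] or by degree, and x has the non-zero scalar c i as i-th
   coordinate. *)
pose x : kmod P := \sum_j c j *: (e j : kmod P).
have xE (y : 'I_n -> P) l : bcoord fb (\sum_j c j *: (y j : kmod P)) l =
    \sum_j c j *: bcoord fb (y j) l.
  by rewrite bcoord_sum; apply: eq_bigr => j _; rewrite kmodE bcoordZ mulr_algl.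
exists x, i, (c i); split=> //.
- exact/eqP.
- rewrite ib; apply: (subspace_sum _ (grading_sub (dgm_grading P) _)) => j _.
  have [/IT[_ <-]|/cI ->] := boolP (I j).
    exact: subspaceZ (grading_sub (dgm_grading P) _) (fb.1.1 j).
  by rewrite scale0r; exact: (grading_sub (dgm_grading P) _).1.
- rewrite xE (bigD1 i) //= bcoord_basis eqxx big1 ?addr0 // => j ji.
  by rewrite bcoord_basis (negPf ji) scaler0.
apply: (gspan_bcoord (fb := fb)) => l lT.
rewrite linear_sum; under eq_bigr do rewrite linearZ.
rewrite (xE (fun j => dgm_d P (e j))).
have [lI|lI] := boolP (I l); first exact: cD.
rewrite big1 // => j _.
have [/IT[jT jb]|/cI ->] := boolP (I j); last by rewrite scale0r.
rewrite [bcoord _ _ _](_ : _ = 0) ?scaler0 //.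
have lb := Ib l lT lI.
have [jl|jl] := eqVneq (dl j + 1) (dl l); first exact: Dmin.
by apply: connA.1 (dcoef_deg j l); lia.
Qed.

(** As j is not in T and x has degree [dl j], replacing e_j by x disturbs neither the degrees nor
    the filtration already built; x enters with the rank #|T|, above all others. *)
Lemma enlarge_filtered i0 : i0 \notin T ->
  exists (e' : 'I_n -> P) (T' : {set 'I_n}) rk',
  filtered e' dl T' rk' /\ #|T'| = #|T|.+1.
Proof.
move=> /new_generator[x [j [c [jT c0 xd xj dx]]]].
have [_ rkT dT] := filtT.
have jS i : i \in T -> (i == j) = false.
  by move=> iT; apply: contraNF jT => /eqP <-.
exists (exchange e j x), (j |: T), (fun i => if i == j then #|T| else rk i).
have cT : #|j |: T| = #|T|.+1 by rewrite cardsU1 jT.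
split=> //; split.
- exact: exchange_free_basis c0 xd xj.
- by move=> i; rewrite cT !inE ltnS; case: eqP => //= _ iT; exact/ltnW/rkT.
move=> i; rewrite !inE {2}/exchange; case: eqP => [_ _|_ /= iT].
  apply: gspanS (exchange_gspan x jT dx) => l /= lT.
  have {}lT : l \in T := lT.
  by rewrite !inE jS // lT; exact: rkT.
have Q : ~~ ((j \in T) && (rk j < rk i)%N) by rewrite (negPf jT).
apply: gspanS (exchange_gspan x Q (dT i iT)) => l /= /andP[lT li].
by rewrite !inE jS // lT.
Qed.

End Step.

Lemma filtered_complete n (e : 'I_n -> P) dl : free_basis e dl ->
  exists (e' : 'I_n -> P) rk, filtered e' dl [set: 'I_n] rk.
Proof.
move=> fb.
suff /(_ n (leqnn n)) [e' [T [rk [fT Tn]]]] : forall m, (m <= n)%N ->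
    exists (e' : 'I_n -> P) T rk, filtered e' dl T rk /\ #|T| = m.
  exists e', rk; suff <- : T = [set: 'I_n] by [].
  by apply/eqP; rewrite eqEcard subsetT cardsT card_ord Tn leqnn.
elim=> [|m IH] mn.
  exists e, set0, (fun=> 0%N); rewrite cards0; split=> //.
  by split=> // i; rewrite inE.
have [e' [T [rk [fT Tm]]]] := IH (ltnW mn).
have /existsP[i0] : [exists i, i \notin T].
  apply: contraTT mn; rewrite -leqNgt -Tm => /existsPn TT.
  rewrite -[X in (X <= _)%N]card_ord -cardsT; apply: subset_leq_card.
  by apply/subsetP => i _; have := TT i; rewrite negbK.
by move=> /(enlarge_filtered fT); rewrite Tm.
Qed.

End Enlarging.

(** * From a filtered basis to semi-freeness *)

Lemma filtered_semi_free (k : fieldType) (A : dgAlg k) (P : dgMod A) n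
    (e : 'I_n -> P) dl rk :
  filtered e dl [set: 'I_n] rk -> semi_free P.
Proof.
move=> [fb _ dT].
(* Semi-freeness speaks of a basis as a set of elements; injectivity of e carries sums over indices
   to sums over elements and keeps the ranks well defined. *)
have e_inj i j : e i = e j -> i = j.
  move=> eij; apply/eqP; have := bcoord_basis fb i j.
  rewrite eij bcoord_basis eqxx; case: eqP => // _ /eqP.
  by rewrite oner_eq0.
have spanE (Q : pred 'I_n) (S : P -> Prop) x :
    (forall i, Q i -> S (e i)) -> gspan e Q x -> submod_span S x.
  move=> QS [c cQ ->].
  exists [seq e i | i <- enum Q], (fun y => \sum_(i | e i == y) c i); split.
    by move=> y /mapP[i]; rewrite mem_enum => iQ ->; exact: QS.
  rewrite big_map (bigID Q) /= addrC big1 ?add0r => [|i /cQ ->]; last first.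
    by rewrite scale0r.
  rewrite big_enum; apply: eq_bigr => i _; rewrite (big_pred1 i) // => j.
  by apply/eqP/eqP => [/e_inj|->].
exists (fun u x => exists2 i, rk i = u & x = e i); split.
- split=> [x|s c us sE s0 y ys].
    apply: (spanE xpredT) => [i _|]; first by exists (rk i), i.
    by apply: (gspan_bcoord (fb := fb)).
  have [_ [i _ yE]] := sE y ys.
  have sum0 : \sum_i (if e i \in s then c (e i) else 0) *: e i = 0.
    rewrite -[RHS]s0; under eq_bigr do rewrite (fun_if (fun a => a *: _)) scale0r.
    rewrite -big_mkcond -big_filter /=.
    rewrite -(big_map e xpredT (fun y => c y *: y)); apply/perm_big/uniq_perm => //.
      by rewrite map_inj_uniq ?filter_uniq ?index_enum_uniq //; exact: e_inj.
    move=> z; apply/mapP/idP => [[j + ->]|zs]; first by rewrite mem_filter => /andP[].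
    have [_ [j _ zj]] := sE z zs.
    by exists j => //; rewrite mem_filter -zj zs mem_index_enum.
  by have := fb.2 _ sum0 i; rewrite -yE ys.
- by move=> u x [i _ ->]; exists (dl i); exact: fb.1.1.
- by move=> u v x [i <- ->] [j <- /e_inj ->].
- move=> x [i ri ->]; have [c c0 ->] := dT i (in_setT i).
  by rewrite big1 // => j _; rewrite c0 ?scale0r // ri andbF.
- move=> u x _ [i <- ->]; apply: spanE (dT i (in_setT i)) => j /andP[_ ji].
  by exists (rk j) => //; exists j.
Qed.

Theorem theorem2p6 (k : closedFieldType) (char0 : [pchar k] =i pred0)
  (A : dgAlg k) (connA : connected A) (P : dgMod A)
  (fgP : finitely_generated P) (projP : semi_projective P) :
  semi_free P.
Proof.
pose gen n := exists e dl, @hom_gen _ _ P n e dl.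
have exn : exists n, `[< gen n >].
  by have [n ngen] := homogeneous_generators fgP; exists n; exact/asboolP.
(* The least number of homogeneous generators, as [minimal_generators_free] requires. *)
case: (ex_minnP exn) => n /asboolP[e [dl egen]] nmin.
have efree : free_basis e dl.
  split=> //; apply: (minimal_generators_free connA projP egen) => m e' dl' egen'.
  by apply: nmin; apply/asboolP; exists e', dl'.
have [e' [rk efilt]] := filtered_complete connA projP efree.
exact: filtered_semi_free efilt.
Qed.
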